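(* Let $q=6$ and let $\{(\mathbf{u}_h^n,p_h^n)\}_{n=q}^N\subset V_h\times Q_h$ be the solution of the fully discrete BDF-$q$ problem: for $n\ge q$, $$(\bar\partial_q\mathbf{u}_h^n,\mathbf{v}_h)+a(\mathbf{u}_h^n,\mathbf{v}_h)+b(p_h^n,\mathbf{v}_h)=(\mathbf{f}^n,\mathbf{v}_h)\quad\forall \mathbf{v}_h\in V_h,\qquad b(q_h,\mathbf{u}_h^n)-j_h(q_h,p_h^n)=0\quad\forall q_h\in Q_h,$$ with initial values $\mathbf{u}_h^i\in V_h$, $i=0,\ldots,q-1$. Suppose that the initial values are discretely divergence-free in the sense that for each $\mathbf{u}_h^i$, $i=0,\ldots,q-1$, there exists a corresponding $p_h^i\in Q_h$ such that $$b(q_h,\mathbf{u}_h^i)-j_h(p_h^i,q_h)=0\qquad\forall q_h\in Q_h .$$ Then for $0\le N\tau\le T$, $$\|\bar\partial_q\mathbf{u}_h^\tau\|_{\ell^2(J_q;H)}^2+\|\mathbf{u}_h^N\|_V^2+|p_h^N|_{j_h}^2\le C\Bigl[\sum_{i=0}^{q-1}\bigl(\|\mathbf{u}_h^i\|_V^2+|p_h^i|_{j_h}^2\bigr)+\|\mathbf{f}\|_{\ell^2(J_q;H)}^2\Bigr],$$ with a constant $C>0$ independent of $h$, $N$, $\tau$ and the final time $T$.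
   Context: Continuous setting. $\Omega\subset\mathbb{R}^d$, $d\in\{2,3\}$, is a Lipschitz domain, $J=(0,T)$, $\nu>0$ a constant. $H=[L^2(\Omega)]^d$, $V=[H_0^1(\Omega)]^d$, $Q=L_0^2(\Omega)$ (mean-zero $L^2$ functions), $(\cdot,\cdot)$ is the $L^2$ inner product, $a(\mathbf{u},\mathbf{v})=(\nu\nabla\mathbf{u},\nabla\mathbf{v})$, $b(p,\mathbf{v})=-(p,\nabla\cdot\mathbf{v})$, $\|\mathbf{v}\|_H=(\mathbf{v},\mathbf{v})^{1/2}$, $\|\mathbf{v}\|_V=a(\mathbf{v},\mathbf{v})^{1/2}$, $\|q\|_Q=\|\nu^{-1/2}q\|_{L^2}$. $c_P$ is the Poincaré constant: $\|\mathbf{v}\|_H\le c_P\nu^{-1/2}\|\mathbf{v}\|_V$ for $\mathbf{v}\in V$. $\|\cdot\|_m$ is the $H^m(\Omega)$ norm. Spatial discretization. $\{\mathcal{T}_h\}_{0<h\le1}$ is a quasi-uniform family of triangulations of $\Omega$ with mesh size $h$. With $k\ge1$, $l\ge0$, $k-1\le l\le k$, $V_h=[X_h]^d\cap V$ where $X_h$ is the space of continuous functions that are piecewise polynomial of degree $k$ on $\mathcal{T}_h$; $M_h\subset L^2(\Omega)$ is the space of (possibly discontinuous) piecewise polynomials of degree $l$; and $Q_h=M_h\cap Q$ or $Q_h=M_h\cap Q\cap C^0(\overline\Omega)$. The pressure stabilization $j_h:Q_h\times Q_h\to\mathbb{R}$ is bilinear, symmetric, positive semi-definite, with induced semi-norm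 $|q_h|_{j_h}=j_h(q_h,q_h)^{1/2}$, and $|j_h(p_h,q_h)|\le|p_h|_{j_h}|q_h|_{j_h}\le C\|p_h\|_Q\|q_h\|_Q$ ($j_h=0$ is allowed for inf-sup stable pairs). It is assumed that there are quasi-interpolation operators $\mathcal{I}_h^p:Q\to Q_h$, $\mathcal{I}_h^{\mathbf{u}}:V\to V_h$ with, for $s_p=\min\{s,\bar l,l+1\}$ ($\bar l\ge1$ the order of weak consistency of $j_h$) and $r_{\mathbf{u}}=\min\{r,k+1\}$: - $|\mathcal{I}_h^pq|_{j_h}\le C\nu^{-1/2}h^{s_p}\|q\|_{s_p}$ for $q\in Q\cap H^s(\Omega)$, and $\|q-\mathcal{I}_h^pq\|_Q\le C\nu^{-1/2}h^{l+1}\|q\|_{l+1}$ for $q\in Q\cap H^{l+1}(\Omega)$; - $\|\mathbf{v}-\mathcal{I}_h^{\mathbf{u}}\mathbf{v}\|_H+h\nu^{-1/2}\|\mathbf{v}-\mathcal{I}_h^{\mathbf{u}}\mathbf{v}\|_V\le C h^{r_{\mathbf{u}}}\|\mathbf{v}\|_{r_{\mathbf{u}}}$ for $\mathbf{v}\in V\cap[H^r(\Omega)]^d$; - $|b(q_h,\mathbf{v}-\mathcal{I}_h^{\mathbf{u}}\mathbf{v})|\le C|q_h|_{j_h}\bigl(\nu^{1/2}\|h^{-1}(\mathbf{v}-\mathcal{I}_h^{\mathbf{u}}\mathbf{v})\|_H+\|\mathbf{v}-\mathcal{I}_h^{\mathbf{u}}\mathbf{v}\|_V\bigr)$ for $(q_h,\mathbf{v})\in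 Q_h\times V$. These constants are independent of $h$. The assumptions imply (known result) the modified inf-sup condition $\beta\|q_h\|_Q\le\sup_{\mathbf{v}_h\in V_h}\frac{|b(q_h,\mathbf{v}_h)|}{\|\mathbf{v}_h\|_V}+C|q_h|_{j_h}$ for all $q_h\in Q_h$, with $\beta,C>0$ independent of $h$ and $\nu$. Time discretization. $t_n=n\tau$, $n=0,\ldots,N$, $\tau=T/N$. The BDF-$q$ discrete derivative is $\bar\partial_q\mathbf{w}^n=\frac1\tau\sum_{i=0}^q\delta_i\mathbf{w}^{n-i}$ for $n\ge q$, with $\delta_i$ defined by $\sum_{i=0}^q\delta_i\zeta^i=\sum_{m=1}^q\frac1m(1-\zeta)^m$. $\mathbf{f}\in C^0([0,T];[L^2(\Omega)]^d)$ and $\mathbf{f}^n=\mathbf{f}(t_n)$. $J_q=(t_q,T)$, and for a sequence $w^\tau=(w^n)_{n=q}^N$, $\|w^\tau\|_{\ell^2(J_q;\mathcal{H})}^2=\tau\sum_{n=q}^N\|w^n\|_{\mathcal{H}}^2$; $\|\mathbf{f}\|_{\ell^2(J_q;H)}$ uses the values $\mathbf{f}^n$. *)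

(* Defs.v *)
From HB Require Import structures.
From mathcomp Require Import all_boot all_order all_algebra.
From mathcomp Require Import all_classical all_reals all_analysis.

Set Implicit Arguments.
Unset Strict Implicit.
Unset Printing Implicit Defensive.

Import Order.TTheory GRing.Theory Num.Theory.
Import numFieldNormedType.Exports.

Local Open Scope classical_set_scope.
Local Open Scope ring_scope.

(* R^n carries the sigma-algebra generated by the coordinate projections,
   which is the Borel sigma-algebra. *)
Section measurable_rV.
Variables (R : realType) (n : nat).

Let coord (i : 'I_n) (x : 'rV[R]_n) : R := x ord0 i.

Let coord_set0 : g_sigma_preimage coord set0.
Proof. exact: sigma_algebra0. Qed.

Let coord_setC A : g_sigma_preimage coord A -> g_sigma_preimage coord (~` A).
Proof. exact: sigma_algebraC. Qed.

Let coord_bigcup (F : (set 'rV[R]_n)^nat) :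
  (forall i, g_sigma_preimage coord (F i)) ->
  g_sigma_preimage coord (\bigcup_i (F i)).
Proof. exact: sigma_algebra_bigcup. Qed.

HB.instance Definition _ := @isMeasurable.Build default_measure_display
  'rV[R]_n (g_sigma_preimage coord) coord_set0 coord_setC coord_bigcup.

End measurable_rV.

Section lebesgue_rV.
Variable R : realType.
Local Open Scope ereal_scope.

Definition rV_cons n (p : R * 'rV[R]_n) : 'rV[R]_n.+1 :=
  \row_i (if unlift ord0 i is Some j then p.2 ord0 j else p.1).

Lemma measurable_coord n (i : 'I_n) :
  measurable_fun [set: 'rV[R]_n] (fun x : 'rV[R]_n => x ord0 i).
Proof.
move=> _ Y mY; rewrite setTI; apply: sub_sigma_algebra => /=.
rewrite -bigcup_seq/=; exists i => /=; first by rewrite mem_index_enum.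
by exists Y => //; rewrite setTI.
Qed.

Lemma measurable_rVP d (T : measurableType d) n (f : T -> 'rV[R]_n) :
  (forall i, measurable_fun [set: T] (fun x => f x ord0 i)) ->
  measurable_fun [set: T] f.
Proof.
move=> mf; apply: (@measurability _ _ _ _ _ _
  (\big[setU/set0]_(i < n) preimage_set_system setT
     (fun x : 'rV[R]_n => x ord0 i) measurable)) => //.
move=> _ [A + <-]; rewrite -bigcup_seq/= => -[i _ [B mB <-]].
rewrite !setTI -[X in measurable X]setTI.
exact: mf.
Qed.

Lemma measurable_rV_cons n : measurable_fun [set: R * 'rV[R]_n] (@rV_cons n).
Proof.
apply: measurable_rVP => i; case: (unliftP ord0 i) => [j|] ->.
- rewrite (_ : (fun _ => _) = (fun x : 'rV[R]_n => x ord0 j) \o snd).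
    exact: (measurableT_comp (measurable_coord j) measurable_snd).
  by apply/funext => p; rewrite /= mxE liftK.
- rewrite (_ : (fun _ => _) = fst); first exact: measurable_fst.
  by apply/funext => p; rewrite mxE unlift_none.
Qed.

Section step.
Variables (n : nat) (m : {sigma_finite_measure set 'rV[R]_n -> \bar R}).

Definition lebesgue_step : set 'rV[R]_n.+1 -> \bar R :=
  pushforward (@lebesgue_measure R \x m) (@rV_cons n).

Let lebesgue_step0 : lebesgue_step set0 = 0.
Proof. by rewrite /lebesgue_step /pushforward preimage_set0 measure0. Qed.

Let lebesgue_step_ge0 A : 0 <= lebesgue_step A.
Proof. exact: integral_ge0. Qed.

Let lebesgue_step_sigma_additive : semi_sigma_additive lebesgue_step.
Proof.
have mcons A : measurable A -> measurable (@rV_cons n @^-1` A).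
  by move=> mA; rewrite -[X in measurable X]setTI; exact: measurable_rV_cons.
move=> F mF tF mUF; rewrite /lebesgue_step /pushforward preimage_bigcup.
apply: measure_semi_sigma_additive.
- by move=> k; exact: mcons.
- apply/trivIsetP => i j _ _ ij; rewrite -preimage_setI.
  by move/trivIsetP : tF => /(_ _ _ _ _ ij) ->//; rewrite preimage_set0.
- by rewrite -preimage_bigcup; exact: mcons.
Qed.

HB.instance Definition _ := isMeasure.Build _ _ _ lebesgue_step
  lebesgue_step0 lebesgue_step_ge0 lebesgue_step_sigma_additive.

Let lebesgue_step_sigma_finite : sigma_finite setT lebesgue_step.
Proof.
have /sigma_finiteP[F [TF ndF Foo]] := sigma_finiteT (@lebesgue_measure R).
have /sigma_finiteP[G [TG ndG Goo]] := sigma_finiteT m.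
pose uncons (x : 'rV[R]_n.+1) : R * 'rV[R]_n :=
  (x ord0 ord0, \row_i x ord0 (lift ord0 i)).
have consK : cancel (@rV_cons n) uncons.
  case=> x v; rewrite /uncons /rV_cons !mxE unlift_none; congr pair.
  by apply/rowP => i; rewrite !mxE liftK.
have muncons : measurable_fun setT uncons.
  apply: measurable_fun_pair; first exact: measurable_coord.
  apply: measurable_rVP => i; rewrite (_ : (fun _ => _) =
    fun x : 'rV[R]_n.+1 => x ord0 (lift ord0 i)); first exact: measurable_coord.
  by apply/funext => x; rewrite /= mxE.
exists (fun k => uncons @^-1` (F k `*` G k)).
  apply/seteqP; split=> // x _.
  have [i _ Fi] : (\bigcup_k F k) (uncons x).1 by rewrite -TF.
  have [j _ Gj] : (\bigcup_k G k) (uncons x).2 by rewrite -TG.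
  exists (maxn i j) => //; split.
  - by move: Fi; exact/subsetPset/ndF/leq_maxl.
  - by move: Gj; exact/subsetPset/ndG/leq_maxr.
move=> k; have [[mFk Fk] [mGk Gk]] := (Foo k, Goo k); split.
  rewrite -[X in measurable X]setTI.
  by apply: muncons => //; exact: measurableX.
rewrite /lebesgue_step /pushforward -comp_preimage.
rewrite (_ : uncons \o _ = id) ?preimage_id; last exact/funext.
by rewrite product_measure1E// lte_mul_pinfty// ge0_fin_numE.
Qed.

HB.instance Definition _ := Measure_isSigmaFinite.Build _ _ _ lebesgue_step
  lebesgue_step_sigma_finite.

End step.

Fixpoint lebesgue_rV n : {sigma_finite_measure set 'rV[R]_n -> \bar R} :=
  if n is n'.+1 then lebesgue_step (lebesgue_rV n') else dirac (0%R : 'rV[R]_0).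

End lebesgue_rV.

Section euclidean.
Variables (R : realType) (d : nat).
Implicit Types (x y e : 'rV[R]_d) (Omega : set 'rV[R]_d).

Definition dotp x y : R := \sum_(i < d) x ord0 i * y ord0 i.
Definition enorm x : R := Num.sqrt (dotp x x).

(* Near each boundary point the domain is the strict epigraph, in the direction
   of a unit vector e, of a Lipschitz function g of the coordinates orthogonal
   to e, that is, of a Lipschitz function on the space invariant along e. *)
Definition lipschitz_domain Omega :=
  [/\ Omega !=set0, open Omega, connected Omega, bounded_set Omega &
    forall x, (closure Omega `\` Omega) x ->
      exists (e : 'rV[R]_d) (g : 'rV[R]_d -> R) (L : R),
        [/\ enorm e = 1,
            forall y t, g (y + t *: e) = g y,
            forall y z, `|g y - g z| <= L * enorm (y - z) &
            \forall y \near x, Omega y <-> g y < dotp y e]].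

End euclidean.

(* Elements of L^2 and of the Sobolev spaces are represented by functions
   defined on the whole of R^d, of which only the restriction to Omega matters
   (up to null sets). *)
Section sobolev.
Variables (R : realType) (d : nat).
Implicit Types (Omega : set 'rV[R]_d) (u f g phi : 'rV[R]_d -> R).
Implicit Types (s : seq 'I_d) (v w : 'rV[R]_d -> 'rV[R]_d).

Definition partial (i : 'I_d) phi : 'rV[R]_d -> R :=
  fun x => 'D_(delta_mx ord0 i) phi x.

Definition pderiv s phi := foldr partial phi s.

Definition smooth phi :=
  forall s, continuous (pderiv s phi) /\
    forall x i, derivable (pderiv s phi) x (delta_mx ord0 i).

Definition test_function Omega phi :=
  smooth phi /\
  exists K, [/\ compact K, K `<=` Omega & forall x, ~ K x -> phi x = 0].

Definition L2 Omega f :=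
  measurable_fun Omega f /\
  (lebesgue_rV R d).-integrable Omega (fun x => (f x ^+ 2)%:E).

Definition ip Omega f g : R := \int[lebesgue_rV R d]_(x in Omega) (f x * g x).

Definition L2norm Omega f : R := Num.sqrt (ip Omega f f).

Definition is_weak_deriv Omega s u g :=
  L2 Omega g /\
  forall phi, test_function Omega phi ->
    ip Omega u (pderiv s phi) = (-1) ^+ size s * ip Omega g phi.

(* Weak derivatives are unique up to null sets; this picks a representative. *)
Definition weak_deriv Omega s u : 'rV[R]_d -> R :=
  xget (fun=> 0) [set g | is_weak_deriv Omega s u g].

(* The directions of differentiation of a multi-index. *)
Definition directions m (alpha : {ffun 'I_d -> 'I_m.+1}) : seq 'I_d :=
  flatten [seq nseq (alpha i) i | i <- enum 'I_d].

Definition sobolev Omega m u :=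
  L2 Omega u /\
  forall alpha : {ffun 'I_d -> 'I_m.+1}, (\sum_i alpha i <= m)%N ->
    exists g, is_weak_deriv Omega (directions alpha) u g.

Definition sobolev_norm Omega m u : R :=
  Num.sqrt (\sum_(alpha : {ffun 'I_d -> 'I_m.+1} | (\sum_i alpha i <= m)%N)
    L2norm Omega (weak_deriv Omega (directions alpha) u) ^+ 2).

(* The closure of the test functions in H^1. *)
Definition sobolev0 Omega u :=
  sobolev Omega 1 u /\
  forall eps, 0 < eps -> exists2 phi, test_function Omega phi &
    L2norm Omega (u - phi) ^+ 2 +
    \sum_(i < d) L2norm Omega (weak_deriv Omega [:: i] u - partial i phi) ^+ 2
      < eps.

Definition component (i : 'I_d) v : 'rV[R]_d -> R := fun x => v x ord0 i.

Definition vsobolev Omega m v := forall i, sobolev Omega m (component i v).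
Definition vsobolev_norm Omega m v : R :=
  Num.sqrt (\sum_(i < d) sobolev_norm Omega m (component i v) ^+ 2).

End sobolev.

Section stokes.
Variables (R : realType) (d : nat) (Omega : set 'rV[R]_d) (nu : R).
Implicit Types (p q : 'rV[R]_d -> R) (v w : 'rV[R]_d -> 'rV[R]_d).

Definition spaceH v := forall i, L2 Omega (component i v).
Definition spaceV v := forall i, sobolev0 Omega (component i v).
Definition spaceQ q :=
  L2 Omega q /\ \int[lebesgue_rV R d]_(x in Omega) q x = 0.

Definition vip v w : R :=
  \sum_(i < d) ip Omega (component i v) (component i w).

Definition divergence v : 'rV[R]_d -> R :=
  \sum_(i < d) weak_deriv Omega [:: i] (component i v).

Definition form_a v w : R :=
  \sum_(i < d) \sum_(j < d)
    ip Omega (nu *: weak_deriv Omega [:: j] (component i v))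
             (weak_deriv Omega [:: j] (component i w)).

Definition form_b p v : R := - ip Omega p (divergence v).

Definition normH v : R := Num.sqrt (vip v v).
Definition normV v : R := Num.sqrt (form_a v v).
Definition normQ q : R := L2norm Omega ((Num.sqrt nu)^-1 *: q).

End stokes.

Section triangulations.
Variables (R : realType) (d : nat).
Implicit Types (S : 'M[R]_(d.+1, d)) (Omega : set 'rV[R]_d).
Implicit Types (Th : seq 'M[R]_(d.+1, d)).

(* The rows of S are the vertices of a simplex; its face spanned by the vertices
   with index in I (empty if I is). *)
Definition face S (I : {set 'I_d.+1}) : set 'rV[R]_d :=
  [set x | exists c : 'rV[R]_d.+1,
    [/\ forall i, 0 <= c ord0 i, \sum_i c ord0 i = 1,
        forall i, i \notin I -> c ord0 i = 0 & x = c *m S]].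

Definition cell S := face S [set: 'I_d.+1].

Definition affinely_independent S := row_free (row_mx S (const_mx 1 : 'cV_d.+1)).

Definition triangulation Omega Th :=
  [/\ forall S, S \in Th -> affinely_independent S,
      closure Omega = [set x | exists2 S, S \in Th & cell S x] &
      forall S S', S \in Th -> S' \in Th ->
        cell S `&` cell S' =
        face S [set i | [exists j, row i S == row j S']]].

(* h bounds the diameters of the cells instead of being their maximum, so that
   the family can be indexed by all of (0, 1] whatever the diameter of Omega. *)
Definition quasi_uniform (T : R -> seq 'M[R]_(d.+1, d)) :=
  exists2 c, 0 < c & forall h S, 0 < h <= 1 -> S \in T h ->
    (forall x y, cell S x -> cell S y -> enorm (x - y) <= h) /\
    (exists x, forall y, enorm (y - x) <= c * h -> cell S y).

End triangulations.

Section finite_elements.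
Variables (R : realType) (d : nat) (Omega : set 'rV[R]_d).
Variable Th : seq 'M[R]_(d.+1, d).
Implicit Types (A : set 'rV[R]_d) (f q : 'rV[R]_d -> R).
Implicit Types (v : 'rV[R]_d -> 'rV[R]_d).

Definition polynomial_on A (k : nat) f :=
  exists c : {ffun 'I_d -> 'I_k.+1} -> R, forall x, A x ->
    f x = \sum_(alpha : {ffun 'I_d -> 'I_k.+1} | (\sum_i alpha i <= k)%N)
            c alpha * \prod_(i < d) x ord0 i ^+ alpha i.

Definition spaceX (k : nat) f :=
  {within closure Omega, continuous f} /\
  forall S, S \in Th -> polynomial_on (cell S) k f.

Definition spaceVh (k : nat) v :=
  (forall i, spaceX k (component i v)) /\ spaceV Omega v.

Definition spaceM (l : nat) q :=
  L2 Omega q /\ forall S, S \in Th -> polynomial_on (interior (cell S)) l q.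

Definition spaceQh (l : nat) (continuous_pressure : bool) q :=
  [/\ spaceM l q, spaceQ Omega q &
      continuous_pressure -> {within closure Omega, continuous q}].

End finite_elements.

Section stabilization.
Variables (R : realType) (d : nat).
Notation scalar := ('rV[R]_d -> R).
Notation field := ('rV[R]_d -> 'rV[R]_d).
Implicit Types (j : scalar -> scalar -> R) (Qh : set scalar) (Vh : set field).

Definition jnorm j q : R := Num.sqrt (j q q).

Definition pressure_stabilization Omega (nu C : R) Qh j :=
  [/\ forall (a : R) p p' q, Qh p -> Qh p' -> Qh q ->
        j (a *: p + p') q = a * j p q + j p' q,
      forall p q, Qh p -> Qh q -> j p q = j q p,
      forall q, Qh q -> 0 <= j q q,
      forall p q, Qh p -> Qh q -> `|j p q| <= jnorm j p * jnorm j q &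
      forall p q, Qh p -> Qh q ->
        jnorm j p * jnorm j q <= C * (normQ Omega nu p * normQ Omega nu q)].

(* l is the pressure degree and lbar the order of weak consistency of j. *)
Definition pressure_interpolation Omega (nu C h : R) (l lbar : nat) Qh j
    (Ip : scalar -> scalar) :=
  [/\ forall q, spaceQ Omega q -> Qh (Ip q),
      forall s q, (1 <= s)%N -> spaceQ Omega q -> sobolev Omega s q ->
        let sp := minn s (minn lbar l.+1) in
        jnorm j (Ip q) <=
          C * (Num.sqrt nu)^-1 * h ^+ sp * sobolev_norm Omega sp q &
      forall q, spaceQ Omega q -> sobolev Omega l.+1 q ->
        normQ Omega nu (q - Ip q) <=
          C * (Num.sqrt nu)^-1 * h ^+ l.+1 * sobolev_norm Omega l.+1 q].

(* k is the velocity degree. *)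
Definition velocity_interpolation Omega (nu C h : R) (k : nat) Vh Qh j
    (Iu : field -> field) :=
  [/\ forall v, spaceV Omega v -> Vh (Iu v),
      forall r v, (1 <= r)%N -> spaceV Omega v -> vsobolev Omega r v ->
        let ru := minn r k.+1 in
        normH Omega (v - Iu v) +
          h * (Num.sqrt nu)^-1 * normV Omega nu (v - Iu v) <=
          C * h ^+ ru * vsobolev_norm Omega ru v &
      forall q v, Qh q -> spaceV Omega v ->
        `|form_b Omega q (v - Iu v)| <=
          C * jnorm j q * (Num.sqrt nu * normH Omega (h^-1 *: (v - Iu v)) +
                           normV Omega nu (v - Iu v))].

End stabilization.

Section bdf.
Variables (R : realType) (U : lmodType R).

Definition bdf_poly (q : nat) : {poly R} :=
  \sum_(1 <= m < q.+1) m%:R^-1 *: (1 - 'X) ^+ m.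

Definition bdf (q : nat) (tau : R) (w : nat -> U) (n : nat) : U :=
  tau^-1 *: \sum_(i < q.+1) (bdf_poly q)`_i *: w (n - i)%N.

End bdf.

(* f in C^0([0,T]; [L^2(Omega)]^d) *)
Definition continuous_in_H (R : realType) d (Omega : set 'rV[R]_d) (T : R)
    (f : R -> 'rV[R]_d -> 'rV[R]_d) :=
  (forall t, 0 <= t <= T -> spaceH Omega (f t)) /\
  (forall t, 0 <= t <= T -> forall eps, 0 < eps ->
    exists2 delta, 0 < delta & forall t', 0 <= t' <= T -> `|t' - t| < delta ->
      normH Omega (f t' - f t) < eps).

Definition l2H_sqr (R : realType) d (Omega : set 'rV[R]_d) (q : nat) (tau : R)
    (N : nat) (w : nat -> 'rV[R]_d -> 'rV[R]_d) : R :=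
  tau * \sum_(q <= n < N.+1) normH Omega (w n) ^+ 2.

(* Main.v *)
(* Write U = (u, p), A((u, p), (v, q)) = a(u, v) + j(p, q) and w^n for the
   discrete derivative of u at n. Since u^n is discretely divergence-free,
   testing the scheme at step k with w^n gives
     tau (w^k, w^n) + A(U^k, sum_i delta_i U^(n-i)) = tau (f^k, w^n).
   For n >= 9, combine the steps k = n, ..., n - 3 with the coefficients of the
   six-step multiplier. Then each term on the left is bounded below by the
   increment of a nonnegative quadratic form of the last values, plus, for the
   first one, a multiple of tau |w^n|^2; both bounds are certified by explicit
   positive semidefinite matrices. The steps n = 6, 7, 8 are estimated one by
   one from the scheme tested with w^n, and summation over n concludes.

   That w^n is an admissible test function requires V_h to be a linear space,
   although weak derivatives are representatives chosen up to null sets. This is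
   the fundamental lemma of the calculus of variations: a function of L^2
   orthogonal to smooth bumps on boxes integrates to 0 over every box, hence, by
   a pi-lambda argument, it vanishes almost everywhere. *)

From HB Require Import structures.
Require Import Defs.
From mathcomp Require Import all_boot all_order all_algebra.
From mathcomp Require Import all_classical all_reals all_analysis.
From mathcomp Require Import measurable_realfun ring lra zify.

Set Implicit Arguments.
Unset Strict Implicit.
Unset Printing Implicit Defensive.

Import Order.TTheory GRing.Theory Num.Theory.
Import numFieldNormedType.Exports.

Local Open Scope classical_set_scope.
Local Open Scope ring_scope.

(** * Certificates for the six-step multiplier *)

Section gram.
Variable R : realFieldType.
Implicit Types (g : nat -> nat -> R) (a b : seq R) (G : seq (seq R)).

Fixpoint lin_form a (h : nat -> R) : R :=
  if a is x :: a' then x * h 0%N + lin_form a' (fun i => h i.+1) else 0.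

Definition gram_form a b g : R := lin_form a (fun i => lin_form b (g i)).

(** A Gram matrix enters only through its entries: the claims below are linear in them, hence within
    reach of [lra] once finitely many squares are supplied. *)
Definition psd_kernel g :=
  (forall i j, g i j = g j i) /\ forall a, 0 <= gram_form a a g.

Fixpoint quad_form G g : R :=
  if G is r :: G' then lin_form r (g 0%N) + quad_form G' (fun i => g i.+1)
  else 0.

Definition shift_kernel g : nat -> nat -> R := fun i j => g i.+1 j.+1.

(** For the Gram kernel of vectors x_i, this is the Gram kernel of the differences x_i - x_(i+1). *)
Definition diff_kernel g : nat -> nat -> R :=
  fun i j => g i j - g i.+1 j - g i j.+1 + g i.+1 j.+1.

(* 36 (1 - z / 2)^2 (1 - 4 z / 9), the multiplier of Akrivis, Chen, Yu and Zhou
   for the six-step BDF method. *)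
Definition multiplier : seq R := [:: 36; - 52; 25; - 4].

(* 60 times the BDF-6 coefficients. *)
Definition bdf6 : seq R := [:: 147; - 360; 450; - 400; 225; - 72; 10].

(* gstab_mx and storage_mx solve semidefinite programs, with entries rounded so
   that gstab_identity is exact. Numerals are unary, hence the integer parts that
   are split off. *)
Definition gstab_mx : seq (seq R) :=
  [:: [:: 437 + 5 / 8; - 848; 804; - 589; 305; - 79];
      [:: - 848; 1935 + 5 / 8; - 2033; 1493; - 859; 267];
      [:: 804; - 2033; 2418 + 3 / 8; - 1869; 1129; - 400];
      [:: - 589; 1493; - 1869; 1602 + 1 / 24; - 1039; 368];
      [:: 305; - 859; 1129; - 1039; 806 + 11 / 12; - 330];
      [:: - 79; 267; - 400; 368; - 330; 171 + 11 / 12]].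

(* A form in the differences x_i - x_(i+1): the form multiplier x bdf6 vanishes
   on constant sequences, because the BDF coefficients add up to 0. *)
Definition gstab_remainder : seq (seq R) :=
  [:: [:: 27 / 8; - (57 / 8); 17; - (37 / 2); 14; - 15];
      [:: - (57 / 8); 355 / 8; - (193 / 2); 317 / 3; - (238 / 3); 257 / 3];
      [:: 17; - (193 / 2); 217 + 3 / 8; - (236 + 1 / 8); 709 / 4; - (767 / 4)];
      [:: - (37 / 2); 317 / 3; - (236 + 1 / 8); 260 + 1 / 24; - (194 + 1 / 12);
          209 + 11 / 12];
      [:: 14; - (238 / 3); 709 / 4; - (194 + 1 / 12); 146 + 11 / 12;
          - (158 + 1 / 12)];
      [:: - 15; 257 / 3; - (767 / 4); 209 + 11 / 12; - (158 + 1 / 12);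
          171 + 11 / 12]].

Definition storage_mx : seq (seq R) :=
  [:: [:: 225; - 127; 22]; [:: - 127; 112; - 21]; [:: 22; - 21; 8]].

Lemma lin_form_nseq i y h : lin_form (ncons i 0 [:: y]) h = y * h i.
Proof.
elim: i h => [|i IH] h /=; first by rewrite addr0.
by rewrite mul0r add0r IH.
Qed.

Lemma psd_kernel_diag g i : psd_kernel g -> 0 <= g i i.
Proof.
move=> [_ /(_ (ncons i 0 [:: 1]))].
by rewrite /gram_form lin_form_nseq mul1r lin_form_nseq mul1r.
Qed.

Lemma lin_formD a h h' :
  lin_form a (fun i => h i + h' i) = lin_form a h + lin_form a h'.
Proof.
by elim: a h h' => [|x a IH] h h' /=; [rewrite addr0|rewrite IH; ring].
Qed.

(** The values at e_i + e_j and e_i - e_j. They bound off-diagonal entries by diagonal ones and so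
    absorb the rounding errors of the certificates. *)
Lemma psd_pair g (i j : nat) : psd_kernel g ->
  0 <= g i i + g j j + 2 * g i j /\ 0 <= g i i + g j j - 2 * g i j.
Proof.
move=> pg; have [sym sq] := pg; wlog ltij : i j / (i < j)%N.
  move=> W; have [ij|ji|->] := ltngtP i j; first exact: W.
    by have [] := W _ _ ji; rewrite (sym j i); lra.
  by have := psd_kernel_diag j pg; lra.
have vec k c h :
    lin_form (ncons i 0 (1 :: ncons k 0 [:: c])) h = h i + c * h (i + k).+1.
  elim: i h {ltij} => [|i IH] h /=; first by rewrite mul1r lin_form_nseq.
  by rewrite mul0r add0r IH.
have [k ->] : exists k, j = (i + k).+1.
  by exists (j - i.+1)%N; rewrite -addSn subnKC.
have := sq (ncons i 0 (1 :: ncons k 0 [:: 1])).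
have := sq (ncons i 0 (1 :: ncons k 0 [:: - 1])).
by rewrite /gram_form !vec (sym _ i); lra.
Qed.

(** Moves every entry to the upper triangle, so that [lra] sees one unknown per symmetric pair. *)
Ltac expand_forms sym :=
  rewrite /gram_form /=
    ?(sym 1 0)%N ?(sym 2 0)%N ?(sym 2 1)%N
    ?(sym 3 0)%N ?(sym 3 1)%N ?(sym 3 2)%N
    ?(sym 4 0)%N ?(sym 4 1)%N ?(sym 4 2)%N ?(sym 4 3)%N
    ?(sym 5 0)%N ?(sym 5 1)%N ?(sym 5 2)%N ?(sym 5 3)%N ?(sym 5 4)%N
    ?(sym 6 0)%N ?(sym 6 1)%N ?(sym 6 2)%N ?(sym 6 3)%N ?(sym 6 4)%N
    ?(sym 6 5)%N.

(** Dahlquist's G-stability identity: up to a remainder, the multiplier paired with the BDF form is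
    the increment of a quadratic form. Symmetry reduces it to a comparison of coefficients. *)
Lemma gstab_identity g : psd_kernel g ->
  gram_form multiplier bdf6 g / 12 =
  quad_form gstab_mx g - quad_form gstab_mx (shift_kernel g) +
  quad_form gstab_remainder (diff_kernel g).
Proof.
move=> [sym _]; rewrite /shift_kernel /diff_kernel.
expand_forms sym.
lra.
Qed.

Lemma gstab_remainder_ge0 g : psd_kernel g -> 0 <= quad_form gstab_remainder g.
Proof.
move=> pg; have [sym sq] := pg.
(* Rows of a rounded Cholesky factor of 28^2 gstab_remainder. What the rounding
   leaves is diagonally dominant, hence a nonnegative combination of the other
   terms below. *)
have := sq [:: 46; - 122; 291; - 316; 239; - 256].
have := sq [:: 0; 139; - 289; 318; - 237; 258].
have := sq [:: 0; 0; 44; - 29; 20; - 29].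
have := sq [:: 0; 0; 0; 35; - 12; 16].
have := sq [:: 0; 0; 0; 0; 24; - 26].
have := sq [:: 0; 0; 0; 0; 0; 13].
have := (psd_pair 0 1 pg).1; have := (psd_pair 0 2 pg).2.
have := (psd_pair 0 3 pg).1; have := (psd_pair 0 4 pg).2.
have := (psd_pair 0 5 pg).1; have := (psd_pair 1 2 pg).1.
have := (psd_pair 1 3 pg).1; have := (psd_pair 1 4 pg).2.
have := (psd_pair 1 5 pg).1; have := (psd_pair 2 3 pg).1.
have := (psd_pair 2 4 pg).1; have := (psd_pair 2 5 pg).1.
have := (psd_pair 3 4 pg).2; have := (psd_pair 3 5 pg).1.
have := (psd_pair 4 5 pg).2.
have := psd_kernel_diag 0 pg; have := psd_kernel_diag 1 pg.
have := psd_kernel_diag 2 pg; have := psd_kernel_diag 3 pg.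
have := psd_kernel_diag 4 pg; have := psd_kernel_diag 5 pg.
expand_forms sym.
lra.
Qed.

(** As in [gstab_remainder_ge0], the vectors are the rows of a rounded Cholesky factor, here of a
    multiple of the difference of the two sides. This is how the form controls the newest energy. *)
Lemma gstab_ge g : psd_kernel g -> g 0%N 0%N <= 24 * quad_form gstab_mx g.
Proof.
move=> pg; have [sym sq] := pg.
have := sq [:: 564; - 1096; 1039; - 761; 394; - 102].
have := sq [:: 0; 457; - 751; 556; - 425; 181].
have := sq [:: 0; 0; 344; - 448; 274; - 144].
have := sq [:: 0; 0; 0; 279; - 352; 91].
have := sq [:: 0; 0; 0; 0; 228; - 227].
have := sq [:: 0; 0; 0; 0; 0; 22].
have := (psd_pair 0 1 pg).2; have := (psd_pair 0 2 pg).1.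
have := (psd_pair 0 3 pg).2; have := (psd_pair 0 4 pg).1.
have := (psd_pair 0 5 pg).2; have := (psd_pair 1 2 pg).2.
have := (psd_pair 1 3 pg).1; have := (psd_pair 1 4 pg).2.
have := (psd_pair 1 5 pg).1; have := (psd_pair 2 3 pg).2.
have := (psd_pair 2 4 pg).1; have := (psd_pair 2 5 pg).2.
have := (psd_pair 3 4 pg).2; have := (psd_pair 3 5 pg).1.
have := (psd_pair 4 5 pg).2.
have := psd_kernel_diag 0 pg; have := psd_kernel_diag 1 pg.
have := psd_kernel_diag 2 pg; have := psd_kernel_diag 3 pg.
have := psd_kernel_diag 4 pg; have := psd_kernel_diag 5 pg.
expand_forms sym.
lra.
Qed.

(** Positivity of the real part of the multiplier on the unit circle, written as a dissipation
    inequality: [storage_mx] is a storage function in the sense of Kalman, Yakubovich and Popov, and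
    1/8 is the margin. *)
Lemma multiplier_dissipation g : psd_kernel g ->
  g 0%N 0%N + quad_form storage_mx g - quad_form storage_mx (shift_kernel g) <=
  8 * gram_form multiplier [:: 1] g.
Proof.
move=> pg; have [sym sq] := pg; rewrite /shift_kernel.
have := sq [:: 39; - 52; 50; - 10].
have := sq [:: 0; 9; - 4; 2].
have := sq [:: 0; 0; 5; 0].
have := sq [:: 0; 0; 0; 7].
have := psd_pair 0 1 pg; have := psd_pair 0 2 pg; have := psd_pair 0 3 pg.
have := psd_pair 1 2 pg; have := psd_pair 1 3 pg; have := psd_pair 2 3 pg.
have := psd_kernel_diag 0 pg; have := psd_kernel_diag 1 pg.
have := psd_kernel_diag 2 pg; have := psd_kernel_diag 3 pg.
expand_forms sym.
lra.
Qed.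

Lemma storage_ge0 g : psd_kernel g -> 0 <= quad_form storage_mx g.
Proof.
move=> pg; have [sym sq] := pg.
have := sq [:: 74; - 43; 7].
have := sq [:: 0; 30; - 7].
have := sq [:: 0; 0; 4].
have := psd_pair 0 1 pg; have := psd_pair 0 2 pg; have := psd_pair 1 2 pg.
have := psd_kernel_diag 0 pg; have := psd_kernel_diag 1 pg.
have := psd_kernel_diag 2 pg.
expand_forms sym.
lra.
Qed.

Lemma storage_le g : psd_kernel g ->
  quad_form storage_mx g <= 400 * (g 0%N 0%N + g 1%N 1%N + g 2%N 2%N).
Proof.
move=> pg; have [sym sq] := pg.
have := psd_pair 0 1 pg; have := psd_pair 0 2 pg; have := psd_pair 1 2 pg.
have := psd_kernel_diag 0 pg; have := psd_kernel_diag 1 pg.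
have := psd_kernel_diag 2 pg.
expand_forms sym.
lra.
Qed.

(** A crude bound, used for the energy at the end of the starting phase. The product [5000 * 2]
    keeps the unary numerals small. *)
Lemma gstab_le g : psd_kernel g ->
  quad_form gstab_mx g <= 5000 * 2 * \sum_(i < 6) g i i.
Proof.
move=> pg; have [sym sq] := pg; rewrite !big_ord_recl big_ord0 /bump /=.
have := (psd_pair 0 1 pg).1; have := (psd_pair 0 2 pg).2.
have := (psd_pair 0 3 pg).1; have := (psd_pair 0 4 pg).2.
have := (psd_pair 0 5 pg).1; have := (psd_pair 1 2 pg).1.
have := (psd_pair 1 3 pg).2; have := (psd_pair 1 4 pg).1.
have := (psd_pair 1 5 pg).2; have := (psd_pair 2 3 pg).1.
have := (psd_pair 2 4 pg).2; have := (psd_pair 2 5 pg).1.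
have := (psd_pair 3 4 pg).1; have := (psd_pair 3 5 pg).2.
have := (psd_pair 4 5 pg).1.
have := psd_kernel_diag 0 pg; have := psd_kernel_diag 1 pg.
have := psd_kernel_diag 2 pg; have := psd_kernel_diag 3 pg.
have := psd_kernel_diag 4 pg; have := psd_kernel_diag 5 pg.
expand_forms sym.
lra.
Qed.
End gram.

(** * Abstract energy estimate *)

Section semi_inner.
Variables (R : realFieldType) (V : lmodType R).
Implicit Types (P : V -> Prop) (B : V -> V -> R) (x : nat -> V) (a b : seq R).

Definition linear_subspace P := forall c u v, P u -> P v -> P (c *: u + v).

(** The laws are relative to [P], since integrals and weak derivatives are linear only on suitable
    spaces of functions. Definiteness is left out: functions equal almost everywhere are not
    identified, and the stabilization is only semi-definite. *)
Record semi_inner P B : Prop := SemiInner {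
  semi_inner_sub : linear_subspace P;
  semi_inner_linear : forall c u v w, P u -> P v -> P w ->
    B (c *: u + v) w = c * B u w + B v w;
  semi_inner_sym : forall u v, P u -> P v -> B u v = B v u;
  semi_inner_ge0 : forall u, P u -> 0 <= B u u }.

Fixpoint lincomb a x : V :=
  if a is c :: a' then c *: x 0%N + lincomb a' (fun i => x i.+1) else 0.

(** An empty [P] also satisfies [linear_subspace], so a member is needed. *)
Lemma subspace0 P u : linear_subspace P -> P u -> P 0.
Proof.
by move=> subP Pu; have := subP (-1) _ _ Pu Pu; rewrite scaleN1r addNr.
Qed.

Lemma subspaceZ P c u : linear_subspace P -> P u -> P (c *: u).
Proof.
by move=> sP Pu; have := sP c _ _ Pu (subspace0 sP Pu); rewrite addr0.
Qed.

Lemma subspaceB P u v : linear_subspace P -> P u -> P v -> P (u - v).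
Proof.
by move=> sP Pu Pv; have := sP (-1) _ _ Pv Pu; rewrite scaleN1r addrC.
Qed.

Lemma lincomb_sub P a x : linear_subspace P -> (forall i, P (x i)) ->
  P (lincomb a x).
Proof.
move=> subP; elim: a x => [|c a IH] x Px /=.
  exact: subspace0 (Px 0%N).
by apply: subP => //; apply: IH.
Qed.

Lemma lincombE a (x : nat -> V) :
  lincomb a x = \sum_(i < size a) a`_i *: x i.
Proof.
elim: a x => [|c a IH] x /=; first by rewrite big_ord0.
by rewrite big_ord_recl IH.
Qed.

Lemma lincomb_linear P (F : V -> R) a x :
  linear_subspace P ->
  (forall c u v, P u -> P v -> F (c *: u + v) = c * F u + F v) ->
  (forall i, P (x i)) -> F (lincomb a x) = lin_form a (fun i => F (x i)).
Proof.
move=> sP Flin; elim: a x => [|c a IH] x Px /=.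
  have := Flin (-1) _ _ (Px 0%N) (Px 0%N).
  by rewrite scaleN1r addNr mulN1r addNr.
by rewrite Flin// ?IH//; exact: lincomb_sub.
Qed.

Section theory.
Variables (P : V -> Prop) (B : V -> V -> R).
Hypothesis siB : semi_inner P B.

Let subP : linear_subspace P := semi_inner_sub siB.

Lemma semi_inner0 v : P v -> B 0 v = 0.
Proof.
move=> Pv; have := semi_inner_linear siB (-1) Pv Pv Pv.
by rewrite scaleN1r addNr mulN1r addNr.
Qed.

Lemma semi_innerB u v w : P u -> P v -> P w -> B (u - v) w = B u w - B v w.
Proof.
move=> Pu Pv Pw; rewrite addrC -scaleN1r (semi_inner_linear siB)//.
by rewrite mulN1r addrC.
Qed.

Lemma semi_inner_linearr c u v w : P u -> P v -> P w ->
  B w (c *: u + v) = c * B w u + B w v.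
Proof.
move=> Pu Pv Pw; rewrite !(semi_inner_sym siB Pw)//; last exact: subP.
by rewrite (semi_inner_linear siB).
Qed.

Lemma semi_innerZr c u w : P u -> P w -> B w (c *: u) = c * B w u.
Proof.
move=> Pu Pw; have P0 := subspace0 (semi_inner_sub siB) Pu.
have := semi_inner_linearr c Pu P0 Pw.
by rewrite addr0 (semi_inner_sym siB Pw P0) (semi_inner0 Pw) addr0.
Qed.

Lemma lincombl a x v : (forall i, P (x i)) -> P v ->
  B (lincomb a x) v = lin_form a (fun i => B (x i) v).
Proof.
move=> Px Pv; apply: (lincomb_linear a (F := B^~ v) subP) => // c u u' Pu Pu'.
exact: (semi_inner_linear siB).
Qed.

Lemma lincombr b x v : (forall i, P (x i)) -> P v ->
  B v (lincomb b x) = lin_form b (fun i => B v (x i)).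
Proof.
move=> Px Pv; rewrite (semi_inner_sym siB)//; last exact: lincomb_sub.
rewrite lincombl//; congr lin_form; apply/funext => i.
exact: semi_inner_sym siB _ _ _ _.
Qed.

Definition gram_kernel x : nat -> nat -> R := fun i j => B (x i) (x j).

Lemma kernel_psd x : (forall i, P (x i)) -> psd_kernel (gram_kernel x).
Proof.
move=> Px; split=> [i j|a]; first exact: semi_inner_sym siB _ _ _ _.
have := semi_inner_ge0 siB (lincomb_sub a subP Px).
rewrite lincombl//; last exact: lincomb_sub.
rewrite /gram_form; congr (_ <= lin_form _ _); apply/funext => i.
by rewrite lincombr.
Qed.

Lemma diff_kernel_psd x : (forall i, P (x i)) ->
  psd_kernel (diff_kernel (gram_kernel x)).
Proof.
move=> Px; rewrite (_ : diff_kernel _ = gram_kernel (fun i => x i - x i.+1)).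
  by apply: kernel_psd => i; exact: subspaceB.
apply/funext => i; apply/funext => j; rewrite /diff_kernel /gram_kernel.
have PB k : P (x k - x k.+1) by exact: subspaceB.
rewrite semi_innerB// !(semi_inner_sym siB _ (PB j))// !semi_innerB//.
rewrite !(semi_inner_sym siB (Px j))// !(semi_inner_sym siB (Px j.+1))//.
ring.
Qed.

(** Nonnegativity of the form at c u - s v. Both weights stay free because each use needs its own
    constants. *)
Lemma semi_inner_young c s u v : P u -> P v ->
  2 * (c * s) * B u v <= c ^+ 2 * B u u + s ^+ 2 * B v v.
Proof.
move=> Pu Pv; pose x i := if i is 0%N then u else v.
have Px i : P (x i) by case: i.
have := (kernel_psd Px).2 [:: c; - s].
by rewrite /gram_form /gram_kernel /= (semi_inner_sym siB Pv Pu); lra.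
Qed.

End theory.
End semi_inner.

(* C = 5200 bounds one starting step; the three starting steps compound to
   1 + C + C (1 + C) + C (1 + C)^2 = (1 + C)^3. The lock keeps the unary numerals
   from being unfolded. *)
Definition energy_const (R : realFieldType) : R :=
  locked (1000 * 1000 * 10 * (1 + 52 * 100) ^+ 3).

Lemma energy_const_ge1 (R : realFieldType) : 1 <= energy_const R.
Proof.
have h : 1 <= (1 + 52 * 100) ^+ 3 :> R by rewrite exprn_ege1// lerDl mulr_ge0.
by rewrite /energy_const -lock; lra.
Qed.

(** * Stability of the multistep recursion for two semi-inner products *)

Section energy.
Variables (R : realFieldType) (W E : lmodType R).
Variables (PW : W -> Prop) (m : W -> W -> R) (PE : E -> Prop) (A : E -> E -> R).
Hypotheses (mP : semi_inner PW m) (AP : semi_inner PE A).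
Variables (N : nat) (w f : nat -> W) (U : nat -> E).
Hypotheses (wP : forall n, PW (w n)) (fP : forall n, PW (f n)).
Hypothesis UP : forall n, PE (U n).
Hypothesis wU : forall k n, (6 <= k <= N)%N -> (6 <= n <= N)%N ->
  m (w k) (w n) + A (U k) (lincomb (bdf6 R) (fun i => U (n - i)%N)) =
  m (f k) (w n).

Let a n := m (w n) (w n).
Let e n := A (U n) (U n).
Let p n := m (f n) (f n).
Let Uk n := gram_kernel A (fun i => U (n - i)%N).
Let wk n := gram_kernel m (fun i => w (n - i)%N).
(** The functional that telescopes. The factors 12 and 1/8 undo the normalizations of
    [gstab_identity] and [multiplier_dissipation]. *)
Let Phi n :=
  12 * quad_form (gstab_mx R) (Uk n) + quad_form (storage_mx R) (wk n) / 8.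

Let a_ge0 n : 0 <= a n. Proof. exact: semi_inner_ge0 mP _ _. Qed.
Let e_ge0 n : 0 <= e n. Proof. exact: semi_inner_ge0 AP _ _. Qed.
Let p_ge0 n : 0 <= p n. Proof. exact: semi_inner_ge0 mP _ _. Qed.

Let AUD k n : A (U k) (lincomb (bdf6 R) (fun i => U (n - i)%N)) =
  lin_form (bdf6 R) (fun i => A (U k) (U (n - i)%N)).
Proof. by rewrite (lincombr AP). Qed.

Lemma starting_step n : (6 <= n <= N)%N ->
  a n + e n <= 52 * 100 * (p n + \sum_(1 <= i < 7) e (n - i)%N).
Proof.
move=> nN; have := wU nN nN; rewrite AUD /= subn0.
(* With weight 40 each of the six cross terms costs 20 [e n], in total 120, less than the leading
   coefficient 147. The older energies get at most 2 * 450^2 / 80 = 5062.5, below 5200. *)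
have y i (c : R) := semi_inner_young AP (40 : R) c (UP n) (UP (n - i)).
have := semi_inner_young mP (1 : R) (1 : R) (fP n) (wP n).
have := y 1%N 360; have := y 2%N (-450); have := y 3%N 400.
have := y 4%N (-225); have := y 5%N 72; have := y 6%N (-10).
do 6 rewrite big_ltn//; rewrite big_geq//.
rewrite -/(e n) -/(a n) -/(p n) -!/(e (_ - _)).
have := a_ge0 n; have := p_ge0 n; have := e_ge0 (n - 1).
have := e_ge0 (n - 2); have := e_ge0 (n - 3); have := e_ge0 (n - 4).
have := e_ge0 (n - 5); have := e_ge0 (n - 6); have := e_ge0 n.
lra.
Qed.

Lemma multistep n : (9 <= n <= N)%N ->
  Phi n + a n / 16 <=
  Phi (n - 1)%N +
  16 * 52 * 52 * (p n + p (n - 1)%N + p (n - 2)%N + p (n - 3)%N).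
Proof.
move=> /andP[n9 nN].
have [n6 n61 n62 n63] : [/\ (6 <= n <= N)%N, (6 <= n - 1 <= N)%N,
  (6 <= n - 2 <= N)%N & (6 <= n - 3 <= N)%N] by split; lia.
have := wU n6 n6; have := wU n61 n6; have := wU n62 n6; have := wU n63 n6.
have psdU := kernel_psd AP (fun i => UP (n - i)).
have psdD := diff_kernel_psd AP (fun i => UP (n - i)).
have psdw := kernel_psd mP (fun i => wP (n - i)).
have := gstab_identity psdU; have := gstab_remainder_ge0 psdD.
have := multiplier_dissipation psdw.
(* Dropping the newest vector passes from n to n - 1, also when the subtraction is truncated. *)
have shiftE (V : lmodType R) (B : V -> V -> R) (x : nat -> V) :
    shift_kernel (gram_kernel B (fun i => x (n - i)%N)) =
    gram_kernel B (fun i => x (n - 1 - i)%N).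
  apply/funext => i; apply/funext => j; rewrite /shift_kernel /gram_kernel.
  by rewrite -!subnDA !add1n.
have multE h : lin_form (multiplier R) h =
  36 * h 0%N + (- 52 * h 1%N + (25 * h 2%N + (- 4 * h 3%N + 0))) by [].
have oneE h : lin_form ([:: 1] : seq R) h = h 0%N by rewrite /= mul1r addr0.
have kE : gram_kernel m (fun i => w (n - 1 - i)%N) = wk (n - 1) by [].
have KE : gram_kernel A (fun i => U (n - 1 - i)%N) = Uk (n - 1) by [].
rewrite !shiftE kE KE /gram_form !multE !oneE -/(wk n) -/(Uk n) !AUD.
rewrite -!/(Uk n _).
(* With weight 1/8, each of the four products costs [a n / 64], so half of the dissipated [a n / 8]
   remains. Here c is four times a multiplier coefficient; the largest square, 208^2 = 16 * 52 * 52,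
   gives the constant. *)
have y j (c : R) := semi_inner_young mP c (8^-1 : R) (fP (n - j)) (wP n).
have := y 0%N 144; have := y 1%N (- 208).
have := y 2%N 100; have := y 3%N (- 16).
rewrite !subn0 -/(p n) -/(a n) -!/(p (_ - _)).
have := p_ge0 n; have := p_ge0 (n - 1); have := p_ge0 (n - 2).
have := p_ge0 (n - 3).
have -> : wk n 0 0 = a n by rewrite /wk /gram_kernel subn0.
have -> : wk n 1 0 = m (w (n - 1)) (w n) by rewrite /wk /gram_kernel subn0.
have -> : wk n 2 0 = m (w (n - 2)) (w n) by rewrite /wk /gram_kernel subn0.
have -> : wk n 3 0 = m (w (n - 3)) (w n) by rewrite /wk /gram_kernel subn0.
rewrite /Phi.
have UE k : (fun i => A (U (n - k)) (U (n - i))) = Uk n k by [].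
have UE0 : (fun i => A (U n) (U (n - i))) = Uk n 0.
  by rewrite /Uk /gram_kernel subn0.
rewrite !UE UE0.
lra.
Qed.

Lemma energy_estimate : (6 <= N)%N ->
  \sum_(6 <= n < N.+1) a n + e N <=
  energy_const R * (\sum_(i < 6) e i + \sum_(6 <= n < N.+1) p n).
Proof.
move=> N6.
(* Opaque names let [lra] take products such as [C1 * S] as unknowns. *)
have [C1 C1E] : exists C : R, C = 52 * 100 by eexists.
have [C2 C2E] : exists C, C = C1 * (1 + C1) by eexists.
have [C3 C3E] : exists C, C = C1 * (1 + C1 + C2) by eexists.
have -> : energy_const R = 1000 * 1000 * 10 * (1 + C1 + C2 + C3).
  by rewrite /energy_const -lock -C1E C3E C2E; ring.
set S := (X in _ * X).
pose F n : R := \sum_(6 <= k < n.+1) p k.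
have FS n : (6 <= n)%N -> F n = F (n - 1)%N + p n.
  move=> n6; rewrite /F big_nat_recr//= subn1 prednK//; lia.
have F_ge0 n : 0 <= F n by apply: sumr_ge0.
have F_le n : (n <= N)%N -> F n <= F N.
  move=> nN; rewrite /F; have [n6|n6] := leqP 6 n.
    by rewrite [leRHS](@big_cat_nat _ _ _ n.+1)//= ?lerDl ?sumr_ge0//; lia.
  by rewrite big_geq//; exact: F_ge0.
have C1_ge0 : 0 <= C1 by rewrite C1E; lra.
have C2_ge0 : 0 <= C2 by rewrite C2E; nra.
have C3_ge0 : 0 <= C3 by rewrite C3E mulr_ge0// ?addr_ge0.
have e0 : \sum_(i < 6) e i = e 0%N + e 1%N + e 2%N + e 3%N + e 4%N + e 5%N.
  by rewrite !big_ord_recr big_ord0/= add0r.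
have SE : S = \sum_(i < 6) e i + F N by [].
have step n : (6 <= n <= N)%N ->
    a n + e n <= C1 * (p n + \sum_(1 <= i < 7) e (n - i)%N).
  by rewrite C1E; exact: starting_step.
have pF n : (6 <= n <= N)%N -> p n <= F N.
  move=> /andP[n6 nN]; have := F_le n nN; have := F_ge0 (n - 1)%N.
  by have := FS n n6; lra.
have S_ge0 : 0 <= S by rewrite SE e0; do ?[apply: addr_ge0].
have Y6 : a 6%N + e 6%N <= C1 * S.
  apply: le_trans (step 6%N _) _ => //; apply: ler_wpM2l => //.
  have := pF 6%N N6; do 6 rewrite big_ltn//; rewrite big_geq// SE e0 /subn /=.
  by lra.
(* The telescoping argument starts from n = 8; for N = 6 and N = 7 the starting steps alone
   conclude. *)
have [N7|N7] := leqP N 6.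
  have -> : N = 6%N by lia.
  rewrite big_nat1; apply: le_trans Y6 _; apply: ler_wpM2r => //; lra.
have Y7 : a 7%N + e 7%N <= C2 * S.
  apply: le_trans (step 7%N _) _ => //; rewrite C2E -mulrA.
  apply: ler_wpM2l => //.
  have := pF 7%N N7; do 6 rewrite big_ltn//; rewrite big_geq//.
  rewrite mulrDl SE e0 -e0 -SE /subn /=; have := a_ge0 6; have := e_ge0 0.
  by move: Y6; rewrite SE e0; lra.
have [N8|N8] := leqP N 7.
  have -> : N = 7%N by lia.
  rewrite big_nat_recr//= big_nat1.
  have := mulr_ge0 C1_ge0 S_ge0; have := mulr_ge0 C2_ge0 S_ge0.
  have := mulr_ge0 C3_ge0 S_ge0; have := e_ge0 6; lra.
have Y8 : a 8%N + e 8%N <= C3 * S.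
  apply: le_trans (step 8%N _) _ => //; rewrite C3E -mulrA.
  apply: ler_wpM2l => //.
  have := pF 8%N N8; do 6 rewrite big_ltn//; rewrite big_geq// !mulrDl mul1r.
  rewrite /subn /=; have := a_ge0 6; have := a_ge0 7.
  have := e_ge0 0; have := e_ge0 1; move: Y6 Y7; rewrite SE e0; lra.
(* Each [multistep] involves four consecutive values of [p], so its sum yields four shifted copies
   of the partial sum [F]. From n = 8 on, the increments of these copies are exactly those
   values. *)
have claim n : (8 <= n <= N)%N ->
    Phi n + (\sum_(9 <= k < n.+1) a k) / 16 <=
    Phi 8 + 16 * 52 * 52 * (F n + F (n - 1)%N + F (n - 2)%N + F (n - 3)%N).
  elim: n => [//|n IH] /andP[n8 nN]; have [n7|n7] := leqP n 7.
    have -> : n = 7%N by lia.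
    rewrite big_geq// mul0r addr0 lerDl; apply: mulr_ge0.
      by rewrite !mulr_ge0.
    by do ?[apply: addr_ge0].
  have /IH {}IH : (8 <= n <= N)%N by lia.
  have n1 : (9 <= n.+1 <= N)%N by lia.
  have sumE : \sum_(9 <= k < n.+2) a k = \sum_(9 <= k < n.+1) a k + a n.+1.
    by rewrite big_nat_recr.
  have := multistep n1; rewrite sumE.
  have -> : (n.+1 - 1 = n)%N by lia.
  have -> : (n.+1 - 2 = n - 1)%N by lia.
  have -> : (n.+1 - 3 = n - 2)%N by lia.
  have -> : F n.+1 = F n + p n.+1 by rewrite FS ?subn1//; lia.
  have FSn k : (k <= 2)%N -> F (n - k)%N = F (n - k.+1)%N + p (n - k)%N.
    by move=> k2; rewrite FS -?subnDA ?addn1//; lia.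
  have := FSn 0%N isT; have := FSn 1%N isT; have := FSn 2%N isT; rewrite subn0.
  by move: IH; lra.
have /claim : (8 <= N <= N)%N by lia.
have psdU n := kernel_psd AP (fun i => UP (n - i)).
have psdw n := kernel_psd mP (fun i => wP (n - i)).
(* At time N the functional dominates [e N / 2]; at time 8 it is bounded by quantities of the
   starting phase. *)
have := gstab_ge (psdU N); have := storage_ge0 (psdw N).
rewrite -/(Uk N) -/(wk N).
have -> : Uk N 0 0 = e N by rewrite /Uk /gram_kernel subn0.
have := gstab_le (psdU 8); have := storage_le (psdw 8).
rewrite -/(Uk 8) -/(wk 8).
have -> : \sum_(i < 6) Uk 8 i i = e 8%N + e 7%N + e 6%N + e 5%N + e 4%N + e 3%N.
  by rewrite !big_ord_recr big_ord0/= add0r.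
have -> : wk 8 0 0 + wk 8 1 1 + wk 8 2 2 = a 8%N + a 7%N + a 6%N by [].
have F1 := F_le (N - 1)%N (leq_subr _ _).
have F2 := F_le (N - 2)%N (leq_subr _ _).
have F3 := F_le (N - 3)%N (leq_subr _ _).
have -> : \sum_(6 <= n < N.+1) a n =
    a 6%N + a 7%N + a 8%N + \sum_(9 <= n < N.+1) a n.
  rewrite (@big_cat_nat _ _ _ 9)//=; congr (_ + _).
  by do 3 rewrite big_ltn//; rewrite big_geq// addr0 !addrA.
rewrite /Phi -/(Uk N) -/(wk N) -/(Uk 8) -/(wk 8).
move: F1 F2 F3 Y6 Y7 Y8 (F_ge0 N).
have := mulr_ge0 C1_ge0 S_ge0; have := mulr_ge0 C2_ge0 S_ge0.
have := mulr_ge0 C3_ge0 S_ge0.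
move: (quad_form _ _) (quad_form _ _) (quad_form _ _) (quad_form _ _).
move=> q1 q2 q3 q4.
have := a_ge0 6; have := a_ge0 7; have := a_ge0 8.
have := e_ge0 6; have := e_ge0 7; have := e_ge0 8.
have := e_ge0 0; have := e_ge0 1; have := e_ge0 2; have := e_ge0 3.
have := e_ge0 4; have := e_ge0 5; have := e_ge0 N.
have := SE; rewrite e0.
lra.
Qed.
End energy.

(** * Fundamental lemma of the calculus of variations *)

Section boxes.
Variables (R : realType) (n : nat).
Implicit Types (a b x : 'rV[R]_n) (U : set 'rV[R]_n).

Definition box a b : set 'rV[R]_n :=
  [set x | forall i, a ord0 i < x ord0 i < b ord0 i].

Lemma boxE a b : box a b = \bigcap_(i in [set: 'I_n])
  ((fun x : 'rV[R]_n => x ord0 i) @^-1` `]a ord0 i, b ord0 i[).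
Proof.
apply/seteqP; split=> x bx i; first by move=> _; rewrite /= in_itv/=; exact: bx.
by have := bx i I; rewrite /= in_itv.
Qed.

Lemma measurable_box a b : measurable (box a b).
Proof.
rewrite boxE; apply: fin_bigcap_measurable => // i _.
rewrite -[X in measurable X]setTI; apply: measurable_coord => //.
Qed.

Lemma boxI a b a' b' : box a b `&` box a' b' =
  box (\row_i Num.max (a ord0 i) (a' ord0 i))
      (\row_i Num.min (b ord0 i) (b' ord0 i)).
Proof.
apply/seteqP; split=> [x [h1 h2] i|x h]; first last.
  split=> i; have := h i; rewrite !mxE gt_max lt_min.
    by move=> /andP[/andP[-> _] /andP[->]].
  by move=> /andP[/andP[_ ->] /andP[_ ->]].
rewrite !mxE gt_max lt_min.
by have /andP[-> ->] := h1 i; have /andP[-> ->] := h2 i.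
Qed.

Definition rat_box (p : 'rV[rat]_n * 'rV[rat]_n) : set 'rV[R]_n :=
  box (map_mx ratr p.1) (map_mx ratr p.2).

(** Balls of the maximum norm are cubes, so a rational box fits between a point and a ball around
    it. Rational corners make the union countable. *)
Lemma open_rat_boxes U : open U ->
  U = \bigcup_(p in [set p | rat_box p `<=` U]) rat_box p.
Proof.
move=> oU; apply/seteqP; split=> [x Ux|x [p /= pU px]]; last exact: pU.
have /nbhs_ballP[e /= e0 eU] : nbhs x U by exact: open_nbhs_nbhs.
have rat_lt (y z : R) : y < z -> exists q : rat, y < ratr q < z.
  by move=> /rat_in_itvoo[q]; rewrite in_itv/= => h; exists q.
have /choice[a aP] i : exists q : rat, x ord0 i - e < ratr q < x ord0 i.
  by apply: rat_lt; rewrite ltrBlDr ltrDl.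
have /choice[b bP] i : exists q : rat, x ord0 i < ratr q < x ord0 i + e.
  by apply: rat_lt; rewrite ltrDl.
exists (\row_i a i, \row_i b i) => /=; last first.
  by move=> i; rewrite !mxE; have /andP[_ ->] := aP i; have /andP[-> _] := bP i.
move=> y yab; apply: eU; split=> // i j; rewrite ord1.
have := yab j; rewrite !mxE; have := aP j; have := bP j.
rewrite -ball_normE /= => /andP[_ h1] /andP[h2 _] /andP[h3 h4].
by rewrite ltr_norml; apply/andP; split; lra.
Qed.

Lemma measurable_open U : open U -> measurable U.
Proof.
move=> /open_rat_boxes ->; rewrite bigcup_mkcond.
apply: countable_bigcupT_measurable => // p.
by case: ifP => // _; exact: measurable_box.
Qed.

Lemma continuous_measurable (f : 'rV[R]_n -> R) : continuous f ->
  measurable_fun setT f.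
Proof.
move=> /continuousP cf.
apply: (measurability _ (RGenOpens.measurableE R)) => _ [_ [a [b ->] <-]].
by rewrite setTI; apply: measurable_open; apply: cf; exact: interval_open.
Qed.
End boxes.

Section box_measure.
Variable R : realType.
Local Open Scope ereal_scope.

(** By induction on the dimension: [rV_cons] pulls a box back to the product of an interval and a
    box, and in dimension 0 the measure is a point mass. *)
Lemma lebesgue_box_lty n (a b : 'rV[R]_n) : lebesgue_rV R n (box a b) < +oo.
Proof.
elim: n a b => [|n IH] a b.
  rewrite (_ : box a b = setT) ?diracT ?ltry//.
  by apply/seteqP; split=> // x _ [].
set a' := (\row_i a ord0 (lift ord0 i))%R.
set b' := (\row_i b ord0 (lift ord0 i))%R.
rewrite /= /lebesgue_step /pushforward.
rewrite (_ : _ @^-1` _ = `]a ord0 ord0, b ord0 ord0[%classic `*` box a' b').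
  rewrite product_measure1E//; last exact: measurable_box.
  apply: lte_mul_pinfty => //.
  rewrite ge0_fin_numE//.
  rewrite [ltLHS](lebesgue_measure_itv `]a ord0 ord0, b ord0 ord0[).
  by case: ifP => // _; exact: ltry.
apply/seteqP; split=> [[t x] h|[t x] [/= h1 h2]].
  split=> [|i] /=.
    by have := h ord0; rewrite /= mxE unlift_none/= in_itv.
  by have := h (lift ord0 i); rewrite /= !mxE liftK.
move=> i; rewrite /= mxE; case: (unliftP ord0 i) => [j|] ->.
  by have := h2 j; rewrite !mxE.
by rewrite in_itv /= in h1.
Qed.

Lemma lebesgue_bounded_lty n (U : set 'rV[R]_n) : measurable U ->
  bounded_set U -> lebesgue_rV R n U < +oo.
Proof.
move=> mU [M [_ /(_ (M + 1)%R)]]; rewrite ltrDl ltr01 => /(_ isT) UM.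
pose c : 'rV[R]_n := const_mx (M + 2)%R.
apply: le_lt_trans (lebesgue_box_lty (- c)%R c).
apply: le_measure; rewrite ?inE//; first exact: measurable_box.
move=> x /UM xM i; rewrite !mxE -ltr_norml.
rewrite (@le_lt_trans _ _ (M + 1)%R) ?ltrD2l ?ltr1n//.
apply: le_trans xM; rewrite [leRHS]mx_normrE.
exact: (le_bigmax _ (fun ij => `|x ij.1 ij.2|)%R (ord0, i)).
Qed.
End box_measure.

(** * Smooth bump functions supported in boxes *)

Section flat.
Variable R : realType.
Implicit Types (t : R) (n : nat).

(** The classical exp(-1/t), with powers of 1/t so that derivatives are linear combinations of
    members of the family. *)
Definition flat n t : R := if 0 < t then t^-1 ^+ n * expR (- t^-1) else 0.

(** One term of the exponential series, y^(n+1) / (n+1)! <= exp y, at y = 1/t. *)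
Lemma flat_bound n t : `|flat n t| <= n.+1`!%:R * `|t|.
Proof.
rewrite /flat; case: ifPn => [t0|_]; last by rewrite normr0 mulr_ge0.
have y0 : 0 < t^-1 by rewrite invr_gt0.
have e0 := expR_gt0 t^-1.
rewrite ger0_norm; last by rewrite mulr_ge0 ?expR_ge0// exprn_ge0// ltW.
rewrite gtr0_norm// expRN ler_pdivrMr//.
have : t^-1 ^+ n.+1 / n.+1`!%:R <= expR t^-1.
  by apply: le_trans (expR_ge1Dxn n (ltW y0)); rewrite lerDr.
rewrite ler_pdivrMr ?ltr0n ?fact_gt0// mulrC => h.
have -> : t^-1 ^+ n = t^-1 ^+ n.+1 * t.
  by rewrite exprSr -mulrA mulVf ?mulr1// gt_eqF.
by rewrite mulrAC ler_wpM2r// ltW.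
Qed.

Lemma is_derive_flat n t :
  is_derive t 1 (flat n) (flat n.+2 t - n%:R * flat n.+1 t).
Proof.
have [t0|t0|<-] := ltgtP 0 t.
- apply: (@near_eq_is_derive _ _ _ (fun t => t^-1 ^+ n * expR (- t^-1))).
    have : \forall x \near t, 0 < x.
      by apply: open_nbhs_nbhs; split; [exact: open_gt|].
    by apply: filterS => x x0; rewrite /flat x0.
  have tn0 : t != 0 by rewrite gt_eqF.
  have di : is_derive t 1 (fun x : R => x^-1) (- t^-2).
    apply: DeriveDef; first exact: derivableV.
    by rewrite deriveV// derive_id [LHS]mulr1.
  have dN (y : R) : is_derive y 1 (fun y => expR (- y)) (- expR (- y)).
    have := is_derive1_comp (is_derive_expR (- y)) (is_deriveNid y 1).
    by rewrite mulrN1.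
  have dP (y : R) : is_derive y 1 ((fun y => y ^+ n) * (fun y => expR (- y)))
      (y ^+ n * - expR (- y) + expR (- y) * (n%:R * y ^+ n.-1)).
    have dX : is_derive y 1 (fun y : R => y ^+ n) (n%:R * y ^+ n.-1).
      apply: DeriveDef; first exact: exprn_derivable.
      by rewrite exp_derive [LHS]mulr1.
    exact: is_deriveM.
  rewrite (_ : (fun t => _) =
    ((fun y => y ^+ n) * (fun y => expR (- y))) \o GRing.inv)//.
  apply: (is_derive_eq (@is_derive1_comp _ _ _ _ _ _ (dP t^-1) di)).
  rewrite /flat t0 -exprVn; set y := t^-1; set e := expR _.
  case: n {dP} => [|n].
    by rewrite !exprS !expr0; ring.
  by rewrite /= !exprS; ring.
- apply: (@near_eq_is_derive _ _ _ (cst 0)).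
    have : \forall x \near t, x < 0.
      by apply: open_nbhs_nbhs; split; [exact: open_lt|].
    by apply: filterS => x x0; rewrite /flat ltNge (ltW x0).
  by rewrite /flat ltNge (ltW t0)/= mulr0 subr0; exact: is_derive_cst.
- have flat0 m : flat m 0 = 0 by rewrite /flat ltxx.
  rewrite !flat0 mulr0 subr0.
  have lim0 : (fun h => h^-1 *: ((flat n \o shift 0) (h *: 1) - flat n 0)) @ 0^'
      --> (0 : R).
    apply/cvgrPdist_lt => e e0; near=> h.
    have h0 : h != 0 by near: h; exact: nbhs_dnbhs_neq.
    rewrite sub0r normrN /= flat0 subr0 addr0 [h *: 1]mulr1 [_ *: _]mulrC.
    (* The difference quotient at 0 is the next member of the family, to which [flat_bound] applies
       again. *)
    have -> : flat n h * h^-1 = flat n.+1 h.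
      by rewrite /flat; case: ifP => _; rewrite ?mul0r// exprSr; ring.
    apply: le_lt_trans (flat_bound _ _) _.
    rewrite -ltr_pdivlMl ?ltr0n ?fact_gt0//.
    near: h; apply: dnbhs0_lt.
    by rewrite mulr_gt0// invr_gt0 ltr0n fact_gt0.
  apply: DeriveDef; last exact: cvg_lim lim0.
  by apply/cvg_ex; exists 0.
Unshelve. all: by end_near. Qed.
End flat.

Section flat_algebra.
Variables (R : realType) (d : nat).
Implicit Types (f g : 'rV[R]_d -> R).

(* Closed under partial derivatives, so that differentiability of its members
   already gives smoothness. *)
Inductive flat_algebra : ('rV[R]_d -> R) -> Prop :=
| flat_algebra_cst c : flat_algebra (cst c)
| flat_algebra_flat n (c r : R) i :
    flat_algebra (fun x => flat n (c * x ord0 i + r))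
| flat_algebraD f g : flat_algebra f -> flat_algebra g -> flat_algebra (f + g)
| flat_algebraM f g : flat_algebra f -> flat_algebra g -> flat_algebra (f * g).

Let coord_linear (c : R) (i : 'I_d) :
  linear (fun x : 'rV[R]_d => c * x ord0 i).
Proof. by move=> a x y; rewrite !mxE /GRing.scale/=; ring. Qed.

Lemma is_diff_affine_coord (c r : R) (i : 'I_d) x :
  is_diff x (fun x : 'rV[R]_d => c * x ord0 i + r) (fun v => c * v ord0 i).
Proof.
pose L := GRing.isLinear.Build _ _ _ _ _ (coord_linear c i).
pose h : {linear 'rV[R]_d -> R} := HB.pack (fun x : 'rV[R]_d => c * x ord0 i) L.
have ch : continuous h.
  move=> y; apply: continuousM; first exact: cst_continuous.
  exact: coord_continuous.
have dh : is_diff x h h.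
  by apply: DiffDef; [exact: linear_differentiable|exact: diff_lin].
have -> : (fun x : 'rV[R]_d => c * x ord0 i + r) =
  (h : 'rV[R]_d -> R) + cst r by [].
by apply: is_diff_eq; rewrite addr0.
Qed.

Lemma flat_algebra_differentiable f x : flat_algebra f -> differentiable f x.
Proof.
elim=> {f} [c|n c r i|f g _ df _ dg|f g _ df _ dg].
- exact: differentiable_cst.
- apply: (@differentiable_comp _ _ _ _ (fun x : 'rV[R]_d => c * x ord0 i + r)
    (flat n)).
    by have [] := is_diff_affine_coord c r i x.
  by apply/derivable1_diffP; have [] := is_derive_flat n (c * x ord0 i + r).
- exact: differentiableD.
- exact: differentiableM.
Qed.

Lemma partial_flat n (c r : R) (i j : 'I_d) :
  partial j (fun x => flat n (c * x ord0 i + r)) =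
  (fun x => flat n.+2 (c * x ord0 i + r)) * cst (c * (i == j)%:R) +
  (fun x => flat n.+1 (c * x ord0 i + r)) * cst (- (n%:R * (c * (i == j)%:R))).
Proof.
apply/funext => x; rewrite /partial.
have [dh hE] := is_diff_affine_coord c r i x.
have df : is_derive (c * x ord0 i + r) 1 (flat n) _ := is_derive_flat n _.
have dF : differentiable (flat n) (c * x ord0 i + r).
  by apply/derivable1_diffP; have [] := df.
rewrite deriveE; last first.
  exact: (flat_algebra_differentiable x (flat_algebra_flat n c r i)).
rewrite (_ : (fun x => flat n _) =
  flat n \o (fun x : 'rV[R]_d => c * x ord0 i + r))//.
rewrite (diff_comp dh dF) /= hE diff1E// derive1E derive_val.
rewrite !mxE eqxx/= eq_sym !fctE /GRing.scale/=.
ring.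
Qed.

Lemma flat_algebra_partial j f : flat_algebra f -> flat_algebra (partial j f).
Proof.
elim=> {f} [c|n c r i|f g ff pf fg pg|f g ff pf fg pg].
- rewrite (_ : partial _ _ = cst 0); first exact: flat_algebra_cst.
  by apply/funext => x; rewrite /partial derive_cst.
- rewrite partial_flat; apply: flat_algebraD; apply: flat_algebraM;
    by [exact: flat_algebra_flat|exact: flat_algebra_cst].
- rewrite (_ : partial _ _ = partial j f + partial j g).
    exact: flat_algebraD.
  by apply/funext => x; rewrite /partial deriveD//; apply: diff_derivable;
    exact: flat_algebra_differentiable.
- rewrite (_ : partial _ _ = f * partial j g + g * partial j f).
    by apply: flat_algebraD; exact: flat_algebraM.
  by apply/funext => x; rewrite /partial deriveM//; apply: diff_derivable;
    exact: flat_algebra_differentiable.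
Qed.

Lemma flat_algebra_smooth f : flat_algebra f -> smooth f.
Proof.
move=> ff s; have : flat_algebra (pderiv s f).
  by elim: s => //= i s; exact: flat_algebra_partial.
move=> fs; split=> [x|x i].
  exact/differentiable_continuous/flat_algebra_differentiable.
exact/diff_derivable/flat_algebra_differentiable.
Qed.

Lemma flat_algebra_prod (I : Type) (s : seq I) (F : I -> 'rV[R]_d -> R) :
  (forall i, flat_algebra (F i)) ->
  flat_algebra (fun x => \prod_(i <- s) F i x).
Proof.
move=> fF; elim: s => [|i s IH].
  rewrite (_ : (fun _ => _) = cst 1); first exact: flat_algebra_cst.
  by apply/funext => x; rewrite big_nil.
rewrite (_ : (fun _ => _) = F i * (fun x => \prod_(i <- s) F i x)).
  exact: flat_algebraM.
by apply/funext => x; rewrite big_cons.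
Qed.

End flat_algebra.

Section box_bump.
Variables (R : realType) (d : nat).
Implicit Types (a b x : 'rV[R]_d) (Omega : set 'rV[R]_d).

(** Each factor vanishes within 1/(m+1) of its face, which makes the support compact in the open
    box, and tends to 1 inside as m grows. The arguments have the affine form expected by
    [flat_algebra_flat]. *)
Definition box_bump a b (m : nat) (x : 'rV[R]_d) : R :=
  \prod_(i < d)
    (flat 0 (m.+1%:R * x ord0 i + (- (m.+1%:R * a ord0 i) - 1)) *
     flat 0 (- m.+1%:R * x ord0 i + (m.+1%:R * b ord0 i - 1))).

Lemma flat_ge0 n (t : R) : 0 <= flat n t.
Proof.
rewrite /flat; case: ifP => // t0; rewrite mulr_ge0 ?expR_ge0// exprn_ge0//.
by rewrite invr_ge0 ltW.
Qed.

Lemma flat0_le1 (t : R) : flat 0 t <= 1.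
Proof.
rewrite /flat; case: ifP => // t0; rewrite expr0 mul1r expR_le1.
by rewrite oppr_le0 invr_ge0 ltW.
Qed.

Lemma box_bump_ge0 a b m x : 0 <= box_bump a b m x.
Proof. by apply: prodr_ge0 => i _; rewrite mulr_ge0 ?flat_ge0. Qed.

Lemma box_bump_le1 a b m x : box_bump a b m x <= 1.
Proof.
apply: prodr_ile1 => i _.
by rewrite mulr_ge0 ?flat_ge0//= mulr_ile1 ?flat_ge0 ?flat0_le1.
Qed.

Lemma box_bump_smooth a b m : smooth (box_bump a b m).
Proof.
apply: flat_algebra_smooth; apply: flat_algebra_prod => i.
exact: (flat_algebraM (flat_algebra_flat _ _ _ _) (flat_algebra_flat _ _ _ _)).
Qed.

Lemma box_bump_eq0 a b m x (i : 'I_d) :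
  ~ (a ord0 i + m.+1%:R^-1 <= x ord0 i <= b ord0 i - m.+1%:R^-1) ->
  box_bump a b m x = 0.
Proof.
move=> /negP; rewrite negb_and -!ltNge => h.
rewrite /box_bump (bigD1 i)//= [X in X * _](_ : _ = 0) ?mul0r//.
have m0 : 0 < m.+1%:R :> R by rewrite ltr0n.
have mV : m.+1%:R * m.+1%:R^-1 = 1 :> R by rewrite divff// gt_eqF.
have flat0 (t : R) : t <= 0 -> flat 0 t = 0.
  by rewrite /flat leNgt => /negbTE ->.
case/orP: h => h; [rewrite flat0 ?mul0r//|rewrite [X in _ * X]flat0 ?mulr0//].
- have : m.+1%:R * x ord0 i < m.+1%:R * (a ord0 i + m.+1%:R^-1).
    by rewrite ltr_pM2l.
  rewrite mulrDr mV; lra.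
- have : m.+1%:R * (b ord0 i - m.+1%:R^-1) < m.+1%:R * x ord0 i.
    by rewrite ltr_pM2l.
  rewrite mulrBr mV; lra.
Qed.

Lemma box_bump_test a b m Omega : box a b `<=` Omega ->
  test_function Omega (box_bump a b m).
Proof.
move=> abO; split; first exact: box_bump_smooth.
pose A (i : 'I_d) := `[a ord0 i + m.+1%:R^-1, b ord0 i - m.+1%:R^-1]%classic.
have m0 : 0 < m.+1%:R^-1 :> R by rewrite invr_gt0 ltr0n.
exists [set x : 'rV[R]_d | forall i, A i (x ord0 i)]; split.
- by apply: rV_compact => i; exact: segment_compact.
- move=> x Ax; apply: abO => i; have := Ax i; rewrite /A /= in_itv/=.
  move=> /andP[h1 h2]; rewrite (lt_le_trans _ h1) ?ltrDl//.
  by rewrite (le_lt_trans h2)// ltrBlDr ltrDl.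
- move=> x /existsNP[i]; rewrite /A /= in_itv/=; exact: box_bump_eq0.
Qed.

Lemma box_bump_notin a b m x : ~ box a b x -> box_bump a b m x = 0.
Proof.
move=> /existsNP[i abx]; apply: (@box_bump_eq0 _ _ _ _ i) => /andP[h1 h2].
apply: abx; have m0 : 0 < m.+1%:R^-1 :> R by rewrite invr_gt0 ltr0n.
by rewrite (lt_le_trans _ h1) ?ltrDl// (le_lt_trans h2)// ltrBlDr ltrDl.
Qed.

Lemma flat0_cvg1 (c : R) : 0 < c ->
  flat 0 (m.+1%:R * c - 1) @[m --> \oo] --> (1 : R).
Proof.
move=> c0; apply/cvgrPdist_lt => e e0; near=> m.
set t := _ - 1.
(* Since 1 - exp(-1/t) <= 1/t, it is enough that t exceeds 1/e. *)
have t0 : e^-1 < t.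
  rewrite ltrBrDr -ltr_pdivrMr//.
  near: m; have /= := @nbhs_infty_gtr R ((e^-1 + 1) / c).
  by apply: filterS => m /lt_le_trans; apply; rewrite ler_nat.
have tp : 0 < t by apply: lt_trans t0; rewrite invr_gt0.
rewrite ger0_norm ?subr_ge0 ?flat0_le1// /flat tp expr0 mul1r.
have := expR_ge1Dx (- t^-1).
have : t^-1 < e by rewrite invf_plt// posrE.
lra.
Unshelve. all: by end_near. Qed.

Lemma box_bump_in a b x : box a b x ->
  box_bump a b m x @[m --> \oo] --> (1 : R).
Proof.
move=> abx; rewrite /box_bump; elim: (index_enum _) => [|i s IH].
  rewrite (_ : (fun m => _) = cst 1); first exact: cvg_cst.
  by apply/funext => m; rewrite big_nil.
have /andP[] := abx i; rewrite -subr_gt0 => ax; rewrite -subr_gt0 => xb.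
have := cvgM (cvgM (flat0_cvg1 ax) (flat0_cvg1 xb)) IH; rewrite !mulr1 => h.
rewrite [X in X @ _](_ : _ = (fun m => flat 0 (m.+1%:R * (x ord0 i - a ord0 i) - 1)
  * flat 0 (m.+1%:R * (b ord0 i - x ord0 i) - 1) * \prod_(i <- s)
    (flat 0 (m.+1%:R * x ord0 i + (- (m.+1%:R * a ord0 i) - 1)) *
     flat 0 (- m.+1%:R * x ord0 i + (m.+1%:R * b ord0 i - 1))))); first exact: h.
apply/funext => m; rewrite big_cons.
by congr (flat _ _ * flat _ _ * _); ring.
Qed.
End box_bump.

(** * Functions orthogonal to all test functions *)

Section measurable_rV_boxes.
Variables (R : realType) (d : nat).

Definition boxes : set (set 'rV[R]_d) := [set A | exists a b, A = box a b].

Lemma open_sigma_boxes U : open U -> <<s boxes >> U.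
Proof.
move=> /open_rat_boxes ->; rewrite bigcup_mkcond.
apply: (@countable_bigcupT_measurable _ (g_sigma_algebraType boxes)) => // p.
case: ifP => // _; apply: sub_sigma_algebra.
by exists (map_mx ratr p.1), (map_mx ratr p.2).
Qed.

(** Boxes replace the coordinate cylinders as generators because they are stable under intersection,
    as a pi-lambda argument requires. *)
Lemma measurable_rV_boxes : @measurable _ 'rV[R]_d = <<s boxes >>.
Proof.
apply/seteqP; split; last first.
  apply: smallest_sub; first exact: sigma_algebra_measurable.
  by move=> _ [a [b ->]]; exact: measurable_box.
apply: smallest_sub; first exact: smallest_sigma_algebra.
move=> A; rewrite -bigcup_seq/= => -[i _ [B mB <-]].
have mc : @measurable_fun _ _ (g_sigma_algebraType boxes) R setT
    (fun x : 'rV[R]_d => x ord0 i).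
  apply: (measurability _ (RGenOpens.measurableE R)) => _ [_ [a [b ->]] <-].
  rewrite setTI; apply: open_sigma_boxes.
  apply: open_comp; last exact: interval_open.
  by move=> x _; exact: coord_continuous.
exact: mc.
Qed.
End measurable_rV_boxes.

Section L2_space.
Variables (R : realType) (d : nat) (Omega : set 'rV[R]_d).
Hypotheses (oO : open Omega) (bO : bounded_set Omega).
Implicit Types (f g z : 'rV[R]_d -> R).
Notation mu := (lebesgue_rV R d).

Let mO : measurable Omega. Proof. exact: measurable_open. Qed.

Lemma L2_integrableM f g : L2 Omega f -> L2 Omega g ->
  mu.-integrable Omega (EFin \o (fun x => f x * g x)).
Proof.
move=> [mf if2] [mg ig2].
apply: (le_integrable mO _ _ (integrableD mO if2 ig2)).
  by apply/measurable_EFinP; exact: measurable_funM.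
move=> x _ /=; rewrite lee_fin normrM.
rewrite [leRHS]ger0_norm ?addr_ge0 ?sqr_ge0//.
have := sqr_ge0 (`|f x| - `|g x|).
rewrite -(real_normK (num_real (f x))) -(real_normK (num_real (g x))).
have := normr_ge0 (f x); have := normr_ge0 (g x); nra.
Qed.

Lemma L2_cst (c : R) : L2 Omega (cst c).
Proof.
split; first exact: measurable_cst.
rewrite (_ : (fun x => _) = cst (c ^+ 2)%:E)//.
apply/integrableP; split; first exact: measurable_cst.
rewrite (_ : (fun x => _) = cst `|c ^+ 2|%:E)//.
rewrite integral_cst// lte_mul_pinfty//.
exact: lebesgue_bounded_lty.
Qed.

Lemma L2_integrable f : L2 Omega f -> mu.-integrable Omega (EFin \o f).
Proof.
move=> Lf; have := L2_integrableM Lf (L2_cst 1).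
by apply: eq_integrable => // x _ /=; rewrite mulr1.
Qed.

(** The bumps converge pointwise to the indicator of the box; dominated convergence with bound |z|
    passes to the limit. *)
Lemma box_integral0 z a b : L2 Omega z ->
  (forall phi, test_function Omega phi -> ip Omega z phi = 0) ->
  box a b `<=` Omega -> (\int[mu]_(x in box a b) (z x)%:E = 0)%E.
Proof.
move=> Lz z0 abO; have iz := L2_integrable Lz.
have mz : measurable_fun Omega z := Lz.1.
have mab := measurable_box a b.
pose F m x : \bar R := (z x * box_bump a b m x)%:E.
have mF m : measurable_fun Omega (F m).
  apply/measurable_EFinP; apply: measurable_funM => //.
  apply: measurable_funTS; apply: continuous_measurable.
  exact: (box_bump_smooth a b m [::]).1.
have zF m x : (`|F m x| <= `|(z x)%:E|)%E.
  rewrite lee_fin normrM ler_piMr// ger0_norm ?box_bump_le1//.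
  exact: box_bump_ge0.
have iF m : mu.-integrable Omega (F m).
  by apply: (le_integrable mO (mF m) _ iz) => x _; exact: zF.
(* [ip] is the [fine] part of an integral, and [fine] also sends infinities to 0; integrability
   excludes them. *)
have F0 m : (\int[mu]_(x in Omega) F m x = 0)%E.
  have := z0 _ (box_bump_test m abO); rewrite /ip /Rintegral => h.
  by rewrite -[LHS]fineK ?h//; exact: integrable_fin_num.
have [] := @dominated_convergence _ _ _ mu Omega mO F
  ((EFin \o z) \_ (box a b)) (fun x => `|(z x)%:E|)%E mF.
- apply/measurable_restrict => //; apply/measurable_EFinP.
  by apply: (measurable_funS mO _ mz); exact: subIsetl.
- apply: aeW => x Ox; rewrite /F patchE; case: ifPn => [/set_mem xab|xab].
    apply: cvg_EFin; first exact: nearW.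
    rewrite -[X in _ --> X]mulr1; apply: cvgM (box_bump_in xab).
    exact: cvg_cst.
  rewrite (_ : (fun m => _) = cst 0%E); first exact: cvg_cst.
  apply/funext => m; rewrite box_bump_notin ?mulr0//.
  by move=> h; move/negP: xab; apply; exact: mem_set.
- exact: integrable_abse.
- by apply: aeW => x m _; exact: zF.
move=> _ _; rewrite -integral_mkcondr setIidr// => h.
apply/esym; apply: (cvg_unique _ _ h) => //.
rewrite (_ : (fun m => _) = cst 0%E); first exact: cvg_cst.
by apply/funext => m; rewrite F0.
Qed.

Lemma ae_zero_box z a b : L2 Omega z ->
  (forall phi, test_function Omega phi -> ip Omega z phi = 0) ->
  box a b `<=` Omega -> ae_eq mu (box a b) (EFin \o z) (cst 0%E).
Proof.
move=> Lz z0 abO; have mab := measurable_box a b.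
have iz : mu.-integrable (box a b) (EFin \o z).
  exact: integrableS (L2_integrable Lz).
apply: integral_ae_eq => // E Eab mE; rewrite integral0.
(* The pi-lambda argument: the sets [A] satisfying this form a lambda-system, and it contains the
   boxes since the intersection of two boxes is a box inside [Omega]. *)
suff : forall A, <<s @boxes R d >> A ->
    (\int[mu]_(x in box a b `&` A) (z x)%:E = 0)%E.
  by rewrite -measurable_rV_boxes => /(_ _ mE); rewrite setIidr.
apply: (dynkin_induction (measurable_rV_boxes R d)).
- move=> _ _ [a1 [b1 ->]] [a2 [b2 ->]]; rewrite boxI.
  by eexists; eexists.
- by rewrite setIT; exact: box_integral0.
- move=> _ [a1 [b1 ->]]; rewrite boxI; apply: box_integral0 => //.
  by rewrite -boxI; apply: subset_trans abO; exact: subIsetl.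
- move=> A mA A0; have := box_integral0 Lz z0 abO.
  rewrite -{1}(setIT (box a b)) -(setUv A) setIUr integral_setU//=.
  + by rewrite A0 add0e.
  + exact: measurableI.
  + by apply: measurableI => //; exact: measurableC.
  + by rewrite -setIUr setUv setIT; exact: measurable_int iz.
  + by apply/disj_setPS => x [[_ Ax] [_]].
- move=> F mF tF F0; rewrite setI_bigcupr integral_bigcup.
  + by rewrite eseries0// => i _ _; rewrite F0.
  + exact: trivIset_setIl.
  + by move=> k; exact: measurableI.
  + apply: integrableS iz => //.
      by apply: bigcup_measurable => k _; exact: measurableI.
    by move=> x [k _ []].
Qed.

Lemma test_orthogonal_ae0 z : L2 Omega z ->
  (forall phi, test_function Omega phi -> ip Omega z phi = 0) ->
  ae_eq mu Omega (EFin \o z) (cst 0%E).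
Proof.
move=> Lz z0.
(* The exceptional set of the rational box with code n, empty if n codes no such box inside [Omega].
   Countably many null sets thus cover all failures. *)
pose F (n : nat) : set 'rV[R]_d :=
  if @unpickle ('rV[rat]_d * 'rV[rat]_d)%type n is Some p then
    if `[< @rat_box R d p `<=` Omega >] then
      ~` [set x | rat_box p x -> (EFin \o z) x = cst 0%E x] else set0
  else set0.
apply: (@negligibleS _ _ _ _ (\bigcup_n F n)).
  move=> x /= /not_implyP[Ox zx].
  have [p /= pO px] :
      (\bigcup_(p in [set p | @rat_box R d p `<=` Omega]) rat_box p) x.
    by rewrite -open_rat_boxes.
  exists (pickle p) => //; rewrite /F pickleK; case: asboolP => //= _.
  by move=> /(_ px).
apply: negligible_bigcup => n; rewrite /F.
case: unpickle => [p|]; last exact: negligible_set0.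
case: asboolP => [pO|_]; last exact: negligible_set0.
exact: ae_zero_box.
Qed.

End L2_space.

(** * Weak derivatives and discrete spaces *)

Section semi_inner_constructions.
Variable R : realFieldType.

Section null.
Variables (V : lmodType R) (P : V -> Prop) (B : V -> V -> R).
Hypothesis siB : semi_inner P B.

Let subP : linear_subspace P := semi_inner_sub siB.

Lemma semi_inner_null z v : P z -> P v -> B z z = 0 -> B z v = 0.
Proof.
move=> Pz Pv z0; have h c := semi_inner_young siB c 1 Pz Pv.
have b0 := semi_inner_ge0 siB Pv.
apply/eqP/negPn/negP => zv0.
(* Young's inequality gives 2 c [B z v] <= [B v v] for all c; this c contradicts it. *)
have := h ((B v v + 1) / B z v); rewrite z0 mulr0 add0r expr1n mul1r mulr1.
by rewrite -mulrA divfK//; lra.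
Qed.

Lemma semi_inner_le c u v : P u -> P v ->
  B (c *: u + v) (c *: u + v) <= 2 * c ^+ 2 * B u u + 2 * B v v.
Proof.
move=> Pu Pv; have Pw : P (c *: u + v) by exact: subP.
rewrite (semi_inner_linear siB)// !(semi_inner_linearr siB)//.
rewrite (semi_inner_sym siB Pv Pu).
have := semi_inner_young siB c 1 Pu Pv; lra.
Qed.

(** Linearity of [L] is asked only up to null vectors, as [weak_deriv] picks representatives that
    need not add up pointwise. *)
Lemma semi_inner_map (U : lmodType R) (P' : U -> Prop) (L : U -> V) :
  linear_subspace P' -> (forall u, P' u -> P (L u)) ->
  (forall c u v, P' u -> P' v -> let z := L (c *: u + v) - (c *: L u + L v) in
    B z z = 0) ->
  semi_inner P' (fun u v => B (L u) (L v)).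
Proof.
move=> sP' PL Lz; split=> //.
- move=> c u v w Pu Pv Pw; have Puv := sP' c _ _ Pu Pv.
  have PLuv : P (c *: L u + L v) by apply: subP; exact: PL.
  have := semi_inner_null (subspaceB subP (PL _ Puv) PLuv) (PL _ Pw)
    (Lz _ _ _ Pu Pv).
  rewrite (semi_innerB siB) ?(semi_inner_linear siB)//; try exact: PL.
  by move/eqP; rewrite subr_eq0 => /eqP.
- by move=> u v Pu Pv; apply: (semi_inner_sym siB); exact: PL.
- by move=> u Pu; apply: (semi_inner_ge0 siB); exact: PL.
Qed.

Lemma semi_innerZ c : 0 <= c -> semi_inner P (fun u v => c * B u v).
Proof.
move=> c0; split=> //.
- by move=> a u v w Pu Pv Pw; rewrite (semi_inner_linear siB)//; ring.
- by move=> u v Pu Pv; rewrite (semi_inner_sym siB).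
- by move=> u Pu; rewrite mulr_ge0// (semi_inner_ge0 siB).
Qed.

End null.

Lemma semi_inner_eq (V : lmodType R) (P : V -> Prop) (B C : V -> V -> R) :
  (forall u v, P u -> P v -> C u v = B u v) ->
  semi_inner P B -> semi_inner P C.
Proof.
move=> BC siB; have sP := semi_inner_sub siB; split=> //.
- move=> c u v w Pu Pv Pw; rewrite !BC//; last exact: sP.
  exact: (semi_inner_linear siB).
- by move=> u v Pu Pv; rewrite !BC//; exact: (semi_inner_sym siB).
- by move=> u Pu; rewrite BC//; exact: (semi_inner_ge0 siB).
Qed.

Lemma semi_inner_subset (V : lmodType R) (P P' : V -> Prop) (B : V -> V -> R) :
  linear_subspace P' -> (forall v, P' v -> P v) -> semi_inner P B ->
  semi_inner P' B.
Proof.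
move=> sP' P'P [_ lin sym pos]; split=> //.
- by move=> c x y z /P'P Px /P'P Py /P'P Pz; exact: lin.
- by move=> x y /P'P Px /P'P Py; exact: sym.
- by move=> x /P'P; exact: pos.
Qed.

Lemma semi_inner_sum (V : lmodType R) (P : V -> Prop) (I : finType)
    (B : I -> V -> V -> R) :
  linear_subspace P -> (forall i, semi_inner P (B i)) ->
  semi_inner P (fun u v => \sum_i B i u v).
Proof.
move=> sP siB; split=> //.
- move=> c u v w Pu Pv Pw; rewrite mulr_sumr -big_split/=.
  by apply: eq_bigr => i _; rewrite (semi_inner_linear (siB i)).
- by move=> u v Pu Pv; apply: eq_bigr => i _; rewrite (semi_inner_sym (siB i)).
- by move=> u Pu; apply: sumr_ge0 => i _; exact: (semi_inner_ge0 (siB i)).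
Qed.

Lemma semi_inner_add (U V : lmodType R) (P : U -> Prop) (Q : V -> Prop) B C :
  semi_inner P B -> semi_inner Q C ->
  semi_inner (fun w : U * V => P w.1 /\ Q w.2)
    (fun w w' => B w.1 w'.1 + C w.2 w'.2).
Proof.
move=> siB siC; split=> [c u v [Pu Qu] [Pv Qv]|c u v w [Pu Qu] [Pv Qv] [Pw Qw]| |].
- by split; [exact: (semi_inner_sub siB)|exact: (semi_inner_sub siC)].
- by rewrite /= (semi_inner_linear siB)// (semi_inner_linear siC)//; ring.
- by move=> u v [Pu Qu] [Pv Qv]; rewrite (semi_inner_sym siB)// (semi_inner_sym siC).
- move=> u [Pu Qu].
  by rewrite addr_ge0 ?(semi_inner_ge0 siB)// (semi_inner_ge0 siC).
Qed.
End semi_inner_constructions.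

(** * The L^2 product and the fundamental lemma in terms of it *)

Section L2_theory.
Variables (R : realType) (d : nat) (Omega : set 'rV[R]_d).
Hypotheses (oO : open Omega) (bO : bounded_set Omega).
Implicit Types (f g u v w z phi : 'rV[R]_d -> R) (c : R).
Notation mu := (lebesgue_rV R d).

Let mO : measurable Omega. Proof. exact: measurable_open. Qed.

Lemma L2_subspace : linear_subspace (L2 Omega).
Proof.
move=> c f g Lf Lg; split.
  by apply: measurable_funD; [apply: measurable_funM => //; exact: Lf.1|exact: Lg.1].
have Lfg := L2_integrableM oO Lf Lg.
have := integrableD mO (integrableD mO (integrableZl mO (c ^+ 2) Lf.2)
  (integrableZl mO (2 * c) Lfg)) Lg.2.
apply: eq_integrable => // x _; rewrite /= !fctE /GRing.scale /= -!EFinM -!EFinD.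
by congr EFin; ring.
Qed.

Lemma ip_semi_inner : semi_inner (L2 Omega) (ip Omega).
Proof.
split; first exact: L2_subspace.
- move=> c f g h Lf Lg Lh; rewrite /ip.
  rewrite -RintegralZl//; last exact: L2_integrableM.
  rewrite -RintegralD//; last exact: L2_integrableM.
    by apply: eq_Rintegral => x _; rewrite /= !fctE /GRing.scale/=; ring.
  have := integrableZl mO c (L2_integrableM oO Lf Lh).
  by apply: eq_integrable => // x _.
- by move=> f g Lf Lg; apply: eq_Rintegral => x _; rewrite mulrC.
- by move=> f Lf; apply: Rintegral_ge0 => x _; rewrite -expr2 sqr_ge0.
Qed.

Lemma continuous_L2 f : continuous f -> L2 Omega f.
Proof.
move=> cf; have mf : measurable_fun Omega f.
  by apply: measurable_funTS; exact: continuous_measurable.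
split=> //.
have [M OM] : exists M, forall x, Omega x -> `|f x| <= M.
  have [M [_ /(_ (M + 1))]] := bO; rewrite ltrDl ltr01 => /(_ isT) OM.
  pose A (i : 'I_d) := `[- (M + 1), M + 1]%classic.
  pose K := [set x : 'rV[R]_d | forall i, A i (x ord0 i)].
  have cK : compact K by apply: rV_compact => i; exact: segment_compact.
  have /compact_bounded[N [_ /(_ (N + 1))]] : compact (f @` K).
    by apply: continuous_compact => //; exact: continuous_subspaceT.
  rewrite ltrDl ltr01 => /(_ isT) KN; exists (N + 1) => x Ox; apply: KN.
  exists x => // i; rewrite /A /= in_itv/= -ler_norml; apply: le_trans (OM _ Ox).
  rewrite [leRHS]mx_normrE.
  exact: (le_bigmax _ (fun ij => `|x ij.1 ij.2|) (ord0, i)).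
apply: (le_integrable mO _ _ (L2_cst oO bO M).2).
  by apply/measurable_EFinP; apply: measurable_funX.
move=> x Ox /=; rewrite lee_fin !normrX lerXn2r ?nnegrE//.
by rewrite (le_trans (OM _ Ox))// ler_norm.
Qed.

Lemma test_orthogonal z : L2 Omega z ->
  (forall phi, test_function Omega phi -> ip Omega z phi = 0) ->
  ip Omega z z = 0.
Proof.
move=> Lz z0; rewrite /ip /Rintegral (ae_eq_integral (cst 0%E))//.
- by rewrite integral0.
- by apply/measurable_EFinP; apply: measurable_funM; exact: Lz.1.
- have := test_orthogonal_ae0 oO bO Lz z0; apply: filterS => x /= h Ox.
  by have := h Ox => -[->]; rewrite mulr0.
Qed.

End L2_theory.

(** * Test functions, weak derivatives and Sobolev spaces *)

Section test_functions.
Variables (R : realType) (d : nat) (Omega : set 'rV[R]_d).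
Implicit Types (f g phi : 'rV[R]_d -> R) (c : R) (s : seq 'I_d).

Lemma pderiv_linear c f g s : smooth f -> smooth g ->
  pderiv s (c *: f + g) = c *: pderiv s f + pderiv s g.
Proof.
move=> sf sg; elim: s => //= i s ->; apply/funext => x.
have df := (sf s).2 x i; have dg := (sg s).2 x i.
rewrite /partial (deriveD (@derivableZ _ _ _ _ c _ _ df) dg).
by rewrite (@deriveZ _ _ _ _ c _ _ df).
Qed.

Lemma smooth_subspace : linear_subspace (@smooth R d).
Proof.
move=> c f g sf sg s; rewrite pderiv_linear//; split.
  move=> x; apply: continuousD; last exact: (sg s).1.
  by apply: continuousZl_tmp; exact: (sf s).1.
move=> x i; apply: derivableD; last exact: (sg s).2.
by apply: derivableZ; exact: (sf s).2.
Qed.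

Lemma test_function_subspace : linear_subspace (test_function Omega).
Proof.
move=> c f g [sf [K [cK KO f0]]] [sg [L [cL LO g0]]].
split; first exact: smooth_subspace.
exists (K `|` L); split; first exact: compactU.
  by rewrite subUset.
move=> x /not_orP[Kx Lx].
by rewrite !fctE f0// g0// scaler0 addr0.
Qed.
End test_functions.

Lemma lt_quarter (R : realFieldType) (c a b a' b' s t eps : R) :
  (a + b) * (c ^+ 2 + 1) < eps / 4 -> a' + b' < eps / 4 -> 0 <= a -> 0 <= b ->
  s <= 2 * c ^+ 2 * a + 2 * a' -> t <= 2 * c ^+ 2 * b + 2 * b' -> s + t < eps.
Proof. lra. Qed.

Section weak_derivatives.
Variables (R : realType) (d : nat) (Omega : set 'rV[R]_d).
Hypotheses (oO : open Omega) (bO : bounded_set Omega).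
Implicit Types (f g u v w z phi : 'rV[R]_d -> R) (c : R) (s : seq 'I_d).

Let si := ip_semi_inner oO.
Let L2sub := L2_subspace oO.

Lemma smooth_L2 s f : smooth f -> L2 Omega (pderiv s f).
Proof. by move=> sf; apply: continuous_L2 => //; exact: (sf s).1. Qed.

Lemma is_weak_deriv_linear c s u v g h : L2 Omega u -> L2 Omega v ->
  is_weak_deriv Omega s u g -> is_weak_deriv Omega s v h ->
  is_weak_deriv Omega s (c *: u + v) (c *: g + h).
Proof.
move=> Lu Lv [Lg ug] [Lh vh]; split; first exact: L2sub.
move=> phi tphi; have Lphi : L2 Omega phi := smooth_L2 [::] tphi.1.
have Lsphi := smooth_L2 s tphi.1.
rewrite !(semi_inner_linear si)// ug// vh//; ring.
Qed.

Lemma weak_derivP s u : (exists g, is_weak_deriv Omega s u g) ->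
  is_weak_deriv Omega s u (weak_deriv Omega s u).
Proof. by move=> [g ug]; rewrite /weak_deriv; case: xgetP => // /(_ g). Qed.

(** After cancelling the sign (-1)^|s|, both derivatives have the same products with test functions;
    the fundamental lemma applies to their difference. *)
Lemma weak_deriv_unique s u g h : is_weak_deriv Omega s u g ->
  is_weak_deriv Omega s u h -> ip Omega (g - h) (g - h) = 0.
Proof.
move=> [Lg ug] [Lh uh]; apply: (test_orthogonal oO bO).
  exact: subspaceB.
move=> phi tphi; have Lphi : L2 Omega phi := smooth_L2 [::] tphi.1.
rewrite (semi_innerB si)//.
apply/eqP; rewrite subr_eq0; apply/eqP.
apply: (@mulfI _ ((-1) ^+ size s)); first by rewrite signr_eq0.
by rewrite -ug// -uh.
Qed.

Lemma weak_deriv_linear c s u v : L2 Omega u -> L2 Omega v ->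
  (exists g, is_weak_deriv Omega s u g) ->
  (exists g, is_weak_deriv Omega s v g) ->
  let z := weak_deriv Omega s (c *: u + v) -
    (c *: weak_deriv Omega s u + weak_deriv Omega s v) in
  ip Omega z z = 0.
Proof.
move=> Lu Lv /weak_derivP Wu /weak_derivP Wv /=.
have Wc := is_weak_deriv_linear c Lu Lv Wu Wv.
exact: weak_deriv_unique (weak_derivP (ex_intro _ _ Wc)) Wc.
Qed.

(** The witness is the unit multi-index at i, for which [directions] returns [[:: i]]. *)
Lemma sobolev1_deriv u i : sobolev Omega 1 u ->
  exists g, is_weak_deriv Omega [:: i] u g.
Proof.
move=> [_ /(_ [ffun j => inord (j == i)])]; set alpha := finfun _.
have alphaE j : alpha j = (j == i) :> nat.
  by rewrite ffunE inordK// ltnS; case: eqP.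
have -> : directions alpha = [:: i].
  rewrite /directions; under eq_map do rewrite alphaE.
  have -> : flatten [seq nseq (j == i) j | j <- enum 'I_d] =
      [seq j <- enum 'I_d | j == i].
    by elim: (enum _) => //= j e ->; case: eqP.
  have := @filter_pred1_uniq _ (enum 'I_d) i (enum_uniq _).
  by rewrite mem_enum; exact.
apply; under eq_bigr do rewrite alphaE.
by rewrite -big_mkcond/= sum1_card card1.
Qed.

Lemma sobolev_subspace m : linear_subspace (sobolev Omega m).
Proof.
move=> c u v [Lu Wu] [Lv Wv]; split; first exact: L2sub.
move=> alpha alpham; have [g ug] := Wu _ alpham; have [h vh] := Wv _ alpham.
by exists (c *: g + h); exact: is_weak_deriv_linear.
Qed.

Lemma L2norm_sqr f : L2norm Omega f ^+ 2 = ip Omega f f.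
Proof.
by rewrite sqr_sqrtr// Rintegral_ge0// => x _; rewrite -expr2 sqr_ge0.
Qed.

Definition L2dist u phi := ip Omega (u - phi) (u - phi).

Definition H1dist u phi := \sum_(i < d)
  L2dist (weak_deriv Omega [:: i] u) (partial i phi).

Lemma L2dist_ge0 u phi : L2 Omega u -> L2 Omega phi -> 0 <= L2dist u phi.
Proof.
by move=> Lu Lphi; exact: (semi_inner_ge0 si (subspaceB L2sub Lu Lphi)).
Qed.

Lemma L2dist_linear c u v phi psi :
  L2 Omega u -> L2 Omega v -> L2 Omega phi -> L2 Omega psi ->
  L2dist (c *: u + v) (c *: phi + psi) <=
  2 * c ^+ 2 * L2dist u phi + 2 * L2dist v psi.
Proof.
move=> Lu Lv Lphi Lpsi; rewrite /L2dist.
have -> : c *: u + v - (c *: phi + psi) = c *: (u - phi) + (v - psi).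
  by rewrite scalerBr opprD addrACA.
exact: (semi_inner_le si c (subspaceB L2sub Lu Lphi) (subspaceB L2sub Lv Lpsi)).
Qed.

(** Lets the chosen derivative of a combination be exchanged for the combination of the chosen
    derivatives. *)
Lemma L2dist_null w u phi : L2 Omega w -> L2 Omega u -> L2 Omega phi ->
  ip Omega (w - u) (w - u) = 0 -> L2dist w phi = L2dist u phi.
Proof.
move=> Lw Lu Lphi; rewrite /L2dist; set z := w - u => z0.
have -> : w - phi = 1 *: z + (u - phi) by rewrite scale1r addrA subrK.
have Lz : L2 Omega z := subspaceB L2sub Lw Lu.
have Ly : L2 Omega (u - phi) := subspaceB L2sub Lu Lphi.
have Lzy : L2 Omega (1 *: z + (u - phi)) := L2sub 1 Lz Ly.
rewrite (semi_inner_linear si 1 Lz Ly Lzy) !(semi_inner_linearr si 1 Lz Ly)//.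
rewrite (semi_inner_sym si Ly Lz) (semi_inner_null si Lz Ly z0) z0; ring.
Qed.

Lemma H1dist_linear c u v phi psi :
  sobolev Omega 1 u -> sobolev Omega 1 v -> smooth phi -> smooth psi ->
  H1dist (c *: u + v) (c *: phi + psi) <=
  2 * c ^+ 2 * H1dist u phi + 2 * H1dist v psi.
Proof.
move=> su sv sphi spsi; rewrite /H1dist !mulr_sumr -big_split/=.
apply: ler_sum => i _.
have Wu := sobolev1_deriv i su; have Wv := sobolev1_deriv i sv.
have Lwu := (weak_derivP Wu).1; have Lwv := (weak_derivP Wv).1.
have Lphi : L2 Omega (partial i phi) := smooth_L2 [:: i] sphi.
have Lpsi : L2 Omega (partial i psi) := smooth_L2 [:: i] spsi.
have Lw := (weak_derivP (sobolev1_deriv i (sobolev_subspace c su sv))).1.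
have := L2dist_null Lw (L2sub c Lwu Lwv) (L2sub c Lphi Lpsi)
  (weak_deriv_linear c su.1 sv.1 Wu Wv).
rewrite -[partial i (c *: phi + psi)]/(pderiv [:: i] (c *: phi + psi)).
rewrite (pderiv_linear c [:: i] sphi spsi) => ->.
exact: L2dist_linear.
Qed.

Lemma H1dist_ge0 u phi : sobolev Omega 1 u -> smooth phi -> 0 <= H1dist u phi.
Proof.
move=> su sphi; apply: sumr_ge0 => i _.
apply: L2dist_ge0; first exact: (weak_derivP (sobolev1_deriv i su)).1.
exact: (smooth_L2 [:: i] sphi).
Qed.

Lemma H1dist_norm u phi :
  L2norm Omega (u - phi) ^+ 2 + \sum_(i < d)
    L2norm Omega (weak_deriv Omega [:: i] u - partial i phi) ^+ 2 =
  L2dist u phi + H1dist u phi.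
Proof.
rewrite L2norm_sqr; congr (_ + _); apply: eq_bigr => i _; exact: L2norm_sqr.
Qed.

Lemma sobolev0_subspace : linear_subspace (sobolev0 Omega).
Proof.
move=> c u v [su au] [sv av]; split; first exact: sobolev_subspace.
move=> eps eps0.
(* Tolerances chosen against the factors 2 c^2 and 2 of [L2dist_linear] and [H1dist_linear]; adding
   1 avoids a division by 0. *)
have c1 : 0 < c ^+ 2 + 1 by rewrite ltr_wpDl ?sqr_ge0.
have e1 : 0 < eps / 4 / (c ^+ 2 + 1) by rewrite !divr_gt0.
have e2 : 0 < eps / 4 by rewrite divr_gt0.
have [phi tphi] := au _ e1; rewrite (H1dist_norm u phi) ltr_pdivlMr// => hu.
have [psi tpsi] := av _ e2; rewrite (H1dist_norm v psi) => hv.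
exists (c *: phi + psi); first exact: test_function_subspace.
rewrite (H1dist_norm (c *: u + v) (c *: phi + psi)).
have Lphi : L2 Omega phi := smooth_L2 [::] tphi.1.
have Lpsi : L2 Omega psi := smooth_L2 [::] tpsi.1.
apply: (lt_quarter hu hv) (L2dist_linear c su.1 sv.1 Lphi Lpsi)
  (H1dist_linear c su sv tphi.1 tpsi.1).
- exact: L2dist_ge0 su.1 Lphi.
- exact: H1dist_ge0 su tphi.1.
Qed.
End weak_derivatives.

(** * Velocity fields and the forms a and b *)

Section fields.
Variables (R : realType) (d : nat) (Omega : set 'rV[R]_d) (nu : R).
Hypotheses (oO : open Omega) (bO : bounded_set Omega) (nu0 : 0 <= nu).
Implicit Types (q : 'rV[R]_d -> R) (u v w : 'rV[R]_d -> 'rV[R]_d).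

Lemma component_linear (i : 'I_d) c u v :
  component i (c *: u + v) = c *: component i u + component i v.
Proof. by apply/funext => x; rewrite /component !fctE !mxE. Qed.

Lemma spaceH_subspace : linear_subspace (spaceH Omega).
Proof.
move=> c u v Hu Hv i; rewrite component_linear.
exact: (L2_subspace oO c (Hu i) (Hv i)).
Qed.

Lemma spaceV_subspace : linear_subspace (spaceV Omega).
Proof.
move=> c u v Vu Vv i; rewrite component_linear.
exact: (sobolev0_subspace oO bO c (Vu i) (Vv i)).
Qed.

Lemma spaceV_H v : spaceV Omega v -> spaceH Omega v.
Proof. by move=> Vv i; exact: (Vv i).1.1. Qed.

Lemma vip_semi_inner : semi_inner (spaceH Omega) (vip Omega).
Proof.
apply: semi_inner_sum => [|i]; first exact: spaceH_subspace.
apply: (semi_inner_map (ip_semi_inner oO) spaceH_subspace) => [u|c u v Hu Hv].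
  exact.
rewrite /= component_linear subrr; apply: (semi_inner0 (ip_semi_inner oO)).
exact: (L2_cst oO bO 0).
Qed.

Lemma component_weak_deriv (i j : 'I_d) v : spaceV Omega v ->
  exists g, is_weak_deriv Omega [:: j] (component i v) g.
Proof. by move=> Vv; apply: sobolev1_deriv; exact: (Vv i).1. Qed.

Lemma component_weak_deriv_L2 (i j : 'I_d) v : spaceV Omega v ->
  L2 Omega (weak_deriv Omega [:: j] (component i v)).
Proof. by move=> /(component_weak_deriv i j)/weak_derivP[]. Qed.

Lemma component_weak_deriv_linear (i j : 'I_d) c u v :
  spaceV Omega u -> spaceV Omega v ->
  let D := fun w => weak_deriv Omega [:: j] (component i w) in
  let z := D (c *: u + v) - (c *: D u + D v) in ip Omega z z = 0.
Proof.
move=> Vu Vv; rewrite /= component_linear.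
exact: (weak_deriv_linear oO bO c (spaceV_H Vu i) (spaceV_H Vv i)
  (component_weak_deriv i j Vu) (component_weak_deriv i j Vv)).
Qed.

(** Each summand is the L^2 product pulled back along one weak derivative of one component and
    scaled by [nu]. *)
Lemma form_a_semi_inner : semi_inner (spaceV Omega) (form_a Omega nu).
Proof.
apply: semi_inner_sum => [|i]; first exact: spaceV_subspace.
apply: semi_inner_sum => [|j]; first exact: spaceV_subspace.
have si := ip_semi_inner oO.
apply: (semi_inner_eq (B := fun u v => nu * ip Omega
    (weak_deriv Omega [:: j] (component i u))
    (weak_deriv Omega [:: j] (component i v)))).
  move=> u v /(component_weak_deriv_L2 i j) Lu /(component_weak_deriv_L2 i j) Lv.
  have L0 : L2 Omega 0 := subspace0 (L2_subspace oO) Lu.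
  have := semi_inner_linear si nu Lu L0 Lv.
  by rewrite addr0 (semi_inner0 si Lv) addr0.
apply: semi_innerZ nu0.
apply: (semi_inner_map si spaceV_subspace
  (L := fun u => weak_deriv Omega [:: j] (component i u))).
  by move=> u; exact: component_weak_deriv_L2.
by move=> c u v Vu Vv; exact: component_weak_deriv_linear.
Qed.

Lemma ip_sumr (I : finType) q (F : I -> 'rV[R]_d -> R) : L2 Omega q ->
  (forall i, L2 Omega (F i)) ->
  ip Omega q (\sum_i F i) = \sum_i ip Omega q (F i).
Proof.
move=> Lq LF; have si := ip_semi_inner oO; have sL := L2_subspace oO.
have L0 : L2 Omega 0 := subspace0 sL Lq.
suff : L2 Omega (\sum_i F i) /\ ip Omega q (\sum_i F i) = \sum_i ip Omega q (F i).
  by case.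
elim/big_rec2 : _ => [|i s g _ [Lg gs]].
  by split=> //; rewrite (semi_inner_sym si Lq L0); exact: (semi_inner0 si Lq).
have := sL 1 _ _ (LF i) Lg; rewrite scale1r => Lig; split=> //.
by have := semi_inner_linearr si 1 (LF i) Lg Lq; rewrite scale1r mul1r gs.
Qed.

(** The derivatives in the divergence are linear up to null functions, which [semi_inner_null] makes
    orthogonal to [q]. *)
Lemma form_b_linear q c u v : L2 Omega q -> spaceV Omega u -> spaceV Omega v ->
  form_b Omega q (c *: u + v) = c * form_b Omega q u + form_b Omega q v.
Proof.
move=> Lq Vu Vv; have si := ip_semi_inner oO; have sL := L2_subspace oO.
have Vw := spaceV_subspace c Vu Vv.
have ipS w : spaceV Omega w -> ip Omega q (divergence Omega w) =
    \sum_(i < d) ip Omega q (weak_deriv Omega [:: i] (component i w)).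
  by move=> {}Vw; apply: ip_sumr => // i; exact: component_weak_deriv_L2.
rewrite /form_b (ipS _ Vu) (ipS _ Vv) (ipS _ Vw).
rewrite mulrN -opprD mulr_sumr -big_split/=; congr (- _).
apply: eq_bigr => i _.
have Lu := component_weak_deriv_L2 i i Vu.
have Lv := component_weak_deriv_L2 i i Vv.
have Lw := component_weak_deriv_L2 i i Vw.
have Lc := sL c _ _ Lu Lv.
have := semi_inner_null si (subspaceB sL Lw Lc) Lq
  (component_weak_deriv_linear i i c Vu Vv).
rewrite (semi_innerB si Lw Lc Lq) => /eqP; rewrite subr_eq0 => /eqP.
rewrite (semi_inner_sym si Lw Lq) => ->.
by rewrite (semi_inner_sym si Lc Lq) (semi_inner_linearr si c Lu Lv Lq).
Qed.

End fields.

Section finite_element_spaces.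
Variables (R : realType) (d : nat) (Omega : set 'rV[R]_d).
Variable Th : seq 'M[R]_(d.+1, d).
Hypotheses (oO : open Omega) (bO : bounded_set Omega).

Lemma polynomial_on_subspace (A : set 'rV[R]_d) k :
  linear_subspace (polynomial_on A k).
Proof.
move=> c f g [a fa] [b gb]; exists (fun alpha => c * a alpha + b alpha) => x Ax.
rewrite !fctE fa// gb// /GRing.scale/= mulr_sumr -big_split/=.
by apply: eq_bigr => alpha _; rewrite mulrDl mulrA.
Qed.

Lemma within_continuous_subspace (A : set 'rV[R]_d) :
  linear_subspace (fun f : 'rV[R]_d -> R => {within A, continuous f}).
Proof.
move=> c f g cf cg x; apply: continuousD; last exact: cg.
by apply: continuousM; [exact: cst_continuous|exact: cf].
Qed.

Lemma spaceVh_subspace k : linear_subspace (spaceVh Omega Th k).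
Proof.
move=> c u v [Xu Vu] [Xv Vv]; split; last exact: spaceV_subspace.
move=> i; rewrite component_linear; split.
  exact: within_continuous_subspace (Xu i).1 (Xv i).1.
move=> S ThS; exact: polynomial_on_subspace ((Xu i).2 _ ThS) ((Xv i).2 _ ThS).
Qed.

Lemma spaceQ_subspace : linear_subspace (spaceQ Omega).
Proof.
move=> c p q [Lp p0] [Lq q0]; split; first exact: L2_subspace.
have L1 := L2_cst oO bO 1.
(* The integral is a product with the constant 1, which is in L^2 as [Omega] is bounded. *)
have e r : \int[lebesgue_rV R d]_(x in Omega) r x = ip Omega r (cst 1).
  by apply: eq_Rintegral => x _; rewrite mulr1.
move: p0 q0; rewrite (e p) (e q) => p0 q0.
rewrite (e (c *: p + q)) (semi_inner_linear (ip_semi_inner oO) c Lp Lq L1).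
by rewrite p0 q0 mulr0 addr0.
Qed.

Lemma spaceQh_subspace l b : linear_subspace (spaceQh Omega Th l b).
Proof.
move=> c p q [[Lp Pp] Qp cp] [[Lq Pq] Qq cq]; split.
- split; first exact: L2_subspace.
  by move=> S ThS; exact: polynomial_on_subspace (Pp _ ThS) (Pq _ ThS).
- exact: spaceQ_subspace.
- by move=> b1; exact: within_continuous_subspace (cp b1) (cq b1).
Qed.

Lemma stabilization_semi_inner nu C (Qh : set ('rV[R]_d -> R)) j :
  linear_subspace Qh -> pressure_stabilization Omega nu C Qh j ->
  semi_inner Qh j.
Proof. by move=> sQ [lin sym pos _ _]; split. Qed.

End finite_element_spaces.

(** * Stability of the scheme *)

Section bdf6.
Variable R : realType.

Lemma coef_exp1BX m i : ((1 - 'X) ^+ m : {poly R})`_i = (-1) ^+ i *+ 'C(m, i).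
Proof.
elim: m i => [|m IH] [|i]; rewrite ?expr0 ?coef1 ?mulr0n ?bin0//.
  by rewrite exprS mulrBl mul1r coefB coefXM/= IH bin0 subr0.
rewrite exprS mulrBl mul1r coefB coefXM/= !IH binS mulrnDr.
by rewrite exprS mulN1r !mulNrn.
Qed.

(** Ties the integer list of the certificates to the generating polynomial; 60 is the least common
    multiple of 1, ..., 6. *)
Lemma bdf_poly6 i : (i < 7)%N -> 60 * (bdf_poly R 6)`_i = (bdf6 R)`_i.
Proof.
rewrite /bdf_poly; do 6 rewrite big_ltn//; rewrite big_geq// addr0.
rewrite !coefD !coefZ !coef_exp1BX.
case: i => [|[|[|[|[|[|[|i]]]]]]] // _; rewrite /binomial /=.
all: lra.
Qed.

Lemma bdf6_lincomb (V : lmodType R) tau (w : nat -> V) n : tau != 0 ->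
  (60 * tau) *: bdf 6 tau w n = lincomb (bdf6 R) (fun i => w (n - i)%N).
Proof.
move=> tau0; rewrite /bdf scalerA mulfK// lincombE scaler_sumr.
by apply: eq_bigr => i _; rewrite scalerA bdf_poly6.
Qed.

End bdf6.

Lemma le_scaled_sum (R : realFieldType) (a e1 e2 K s b : R) :
  60 * a + (e1 + e2) <= K * (s + 60 * b) ->
  0 <= a -> 1 <= K -> 0 <= s -> 0 <= b -> a + e1 + e2 <= 60 * K * (s + b).
Proof.
move=> h a0 K1 s0 b0; have : 0 <= K * s by rewrite mulr_ge0//; lra.
lra.
Qed.

(** * The scheme as an instance of the abstract recursion *)

Section fully_discrete.
Variables (R : realType) (d : nat) (Omega : set 'rV[R]_d) (nu : R).
Hypotheses (oO : open Omega) (bO : bounded_set Omega) (nu0 : 0 <= nu).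
Variables (Vh : set ('rV[R]_d -> 'rV[R]_d)) (Qh : set ('rV[R]_d -> R)).
Variable j : ('rV[R]_d -> R) -> ('rV[R]_d -> R) -> R.
Hypotheses (sVh : linear_subspace Vh) (VhV : Vh `<=` spaceV Omega).
Hypotheses (siJ : semi_inner Qh j) (QhL2 : Qh `<=` L2 Omega).
Variables (tau : R) (N : nat) (tau0 : 0 < tau).
Variables (u f : nat -> 'rV[R]_d -> 'rV[R]_d) (p : nat -> 'rV[R]_d -> R).
Hypothesis uP : forall n, (n <= N)%N -> Vh (u n) /\ Qh (p n).
Hypothesis fP : forall n, (6 <= n <= N)%N -> spaceH Omega (f n).
Hypothesis bup : forall n, (n <= N)%N ->
  forall q, Qh q -> form_b Omega q (u n) = j q (p n).
Hypothesis scheme : forall n, (6 <= n <= N)%N -> forall v, Vh v ->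
  vip Omega (bdf 6 tau u n) v + form_a Omega nu (u n) v +
  form_b Omega (p n) v = vip Omega (f n) v.

(* Indices are clamped because energy_estimate wants its membership hypotheses for
   all n. *)
Let w := bdf 6 tau u.
Let U n := u (minn n N).
Let Q n := p (minn n N).
Let clamp n := maxn 6 (minn n N).

Let UVh n : Vh (U n). Proof. by apply: (uP _).1; exact: geq_minr. Qed.
Let QQh n : Qh (Q n). Proof. by apply: (uP _).2; exact: geq_minr. Qed.

Let UQ n := (U n, Q n).
Let UQP n : Vh (UQ n).1 /\ Qh (UQ n).2.
Proof. by split; [exact: UVh|exact: QQh]. Qed.

Let lincombU n : (n <= N)%N ->
  (60 * tau) *: w n = lincomb (bdf6 R) (fun i => U (n - i)%N).
Proof.
move=> nN; rewrite /w (bdf6_lincomb u n (lt0r_neq0 tau0)).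
congr lincomb; apply/funext => i.
by rewrite /U (minn_idPl _)// (leq_trans _ nN)// leq_subr.
Qed.

Let w_Vh n : (n <= N)%N -> Vh (w n).
Proof.
move=> nN; have t0 : 60 * tau != 0 by rewrite mulf_neq0// lt0r_neq0.
rewrite -[w n]scale1r -(mulVf t0) -scalerA (lincombU nN).
exact: (subspaceZ _ sVh (lincomb_sub _ sVh (fun i => UVh (n - i)))).
Qed.

Definition energy_form (x y : ('rV[R]_d -> 'rV[R]_d) * ('rV[R]_d -> R)) : R :=
  form_a Omega nu x.1 y.1 + j x.2 y.2.

Let siV : semi_inner (spaceV Omega) (form_a Omega nu).
Proof. exact: form_a_semi_inner. Qed.

Let siE : semi_inner (fun x => Vh x.1 /\ Qh x.2) energy_form.
Proof. exact: (semi_inner_add (semi_inner_subset sVh VhV siV) siJ). Qed.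

(** The weight turns the scheme tested with the discrete derivative into the hypothesis of
    [energy_estimate], with integer coefficients. *)
Let siW : semi_inner (spaceH Omega) (fun v v' => 60 * tau * vip Omega v v').
Proof.
have t0 : 0 <= 60 * tau by rewrite mulr_ge0// ltW.
exact: (semi_innerZ (vip_semi_inner oO bO) t0).
Qed.

(** The pressure term b(p^k, w^n) expands into the b(p^k, u^(n-i)), which the divergence constraint
    at time n - i turns into j(p^k, p^(n-i)). Some of these times are below 6, hence the condition
    on the initial values. *)
Let tested k n : (6 <= k <= N)%N -> (6 <= n <= N)%N ->
  60 * tau * vip Omega (w k) (w n) +
  energy_form (UQ k) (lincomb (bdf6 R) (fun i => UQ (n - i)%N)) =
  60 * tau * vip Omega (f k) (w n).
Proof.
move=> k6 n6; have /andP[_ kN] := k6; have /andP[_ nN] := n6.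
have Uk : U k = u k by rewrite /U (minn_idPl kN).
have Qk : Q k = p k by rewrite /Q (minn_idPl kN).
rewrite (lincombr siE (bdf6 R) (fun i => UQP (n - i)) (UQP k)).
rewrite [lin_form _ _](lin_formD (bdf6 R)
  (fun i => form_a Omega nu (U k) (U (n - i)%N))
  (fun i => j (Q k) (Q (n - i)%N))).
rewrite -(scheme k6 (w_Vh nN)) 2!mulrDr -[RHS]addrA.
have Vw := VhV (w_Vh nN).
have Vk : spaceV Omega (u k) by rewrite -Uk; exact: VhV.
congr (_ + (_ + _)).
  have la := lincombr siV (bdf6 R) (fun i => VhV (UVh (n - i))) (VhV (UVh k)).
  rewrite -[LHS]la -(lincombU nN) Uk.
  exact: (semi_innerZr siV (60 * tau) Vw Vk).
have Lk : L2 Omega (p k) by rewrite -Qk; exact: QhL2.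
have blin c v v' (Vv : spaceV Omega v) (Vv' : spaceV Omega v') :=
  form_b_linear oO bO c Lk Vv Vv'.
have lb := lincomb_linear (bdf6 R) (spaceV_subspace oO bO) blin
  (fun i => VhV (UVh (n - i))).
rewrite [LHS](_ : _ =
  lin_form (bdf6 R) (fun i => form_b Omega (p k) (U (n - i)%N))).
  rewrite -[LHS]lb -(lincombU nN).
  have V0 := subspace0 (spaceV_subspace oO bO) Vw.
  have b0 : form_b Omega (p k) 0 = 0.
    by have := blin (-1) _ _ V0 V0; rewrite scaler0 addr0 mulN1r addNr.
  by have := blin (60 * tau) _ _ Vw V0; rewrite addr0 b0 addr0.
congr lin_form; apply/funext => i; apply/esym; rewrite -Qk.
exact: (bup (geq_minr _ _) (QQh k)).
Qed.

Lemma normH_sqr v : spaceH Omega v -> normH Omega v ^+ 2 = vip Omega v v.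
Proof.
by move=> Hv; rewrite sqr_sqrtr// (semi_inner_ge0 (vip_semi_inner oO bO) Hv).
Qed.

Lemma normV_sqr v : spaceV Omega v ->
  normV Omega nu v ^+ 2 = form_a Omega nu v v.
Proof. by move=> Vv; rewrite sqr_sqrtr// (semi_inner_ge0 siV Vv). Qed.

Lemma jnorm_sqr q : Qh q -> jnorm j q ^+ 2 = j q q.
Proof. by move=> Qq; rewrite sqr_sqrtr// (semi_inner_ge0 siJ Qq). Qed.

Lemma discrete_stability :
  l2H_sqr Omega 6 tau N w + normV Omega nu (u N) ^+ 2 + jnorm j (p N) ^+ 2 <=
  60 * energy_const R *
    (\sum_(i < 6) (normV Omega nu (u i) ^+ 2 + jnorm j (p i) ^+ 2) +
     l2H_sqr Omega 6 tau N f).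
Proof.
have K1 := energy_const_ge1 R.
have Vu n : (n <= N)%N -> spaceV Omega (u n) by move=> nN; exact: VhV (uP nN).1.
have S0 : 0 <= \sum_(i < 6) (normV Omega nu (u i) ^+ 2 + jnorm j (p i) ^+ 2).
  by apply: sumr_ge0 => i _; rewrite addr_ge0// sqr_ge0.
(* For N < 6 the time sums are empty and [u N], [p N] are among the initial data, so a constant at
   least 1 suffices. *)
have [N6|N6] := ltnP N 6.
  rewrite /l2H_sqr !big_geq// !mulr0 add0r addr0.
  apply: (@le_trans _ _
    (\sum_(i < 6) (normV Omega nu (u i) ^+ 2 + jnorm j (p i) ^+ 2))).
    rewrite (bigD1 (Ordinal N6))//= lerDl; apply: sumr_ge0 => i _.
    by rewrite addr_ge0// sqr_ge0.
  by rewrite ler_peMl//; lra.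
have clampP n : (6 <= clamp n <= N)%N by rewrite /clamp; lia.
have wH n : spaceH Omega (w (clamp n)).
  by have /andP[_ h] := clampP n; exact: spaceV_H (VhV (w_Vh h)).
have fH n : spaceH Omega (f (clamp n)) by exact: fP.
have clampE n : (6 <= n <= N)%N -> clamp n = n by rewrite /clamp; lia.
have step k n : (6 <= k <= N)%N -> (6 <= n <= N)%N ->
    60 * tau * vip Omega (w (clamp k)) (w (clamp n)) +
    energy_form (UQ k) (lincomb (bdf6 R) (fun i => UQ (n - i)%N)) =
    60 * tau * vip Omega (f (clamp k)) (w (clamp n)).
  by move=> k6 n6; rewrite (clampE _ k6) (clampE _ n6); exact: tested.
have := energy_estimate siW siE wH fH UQP step N6.
have sumE g : (forall n, spaceH Omega (g (clamp n))) ->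
    \sum_(6 <= n < N.+1) 60 * tau * vip Omega (g (clamp n)) (g (clamp n)) =
    60 * l2H_sqr Omega 6 tau N g.
  move=> Hg; rewrite /l2H_sqr !mulr_sumr; apply: eq_big_nat => n /andP[n6 nN].
  have nn : (6 <= n <= N)%N by rewrite n6.
  have := Hg n; rewrite (clampE _ nn) => Hgn.
  by rewrite (normH_sqr Hgn) mulrA.
have eE n : (n <= N)%N -> energy_form (UQ n) (UQ n) =
    normV Omega nu (u n) ^+ 2 + jnorm j (p n) ^+ 2.
  move=> nN; rewrite (normV_sqr (Vu _ nN)) (jnorm_sqr (uP nN).2).
  have Un : U n = u n by rewrite /U (minn_idPl nN).
  have Qn : Q n = p n by rewrite /Q (minn_idPl nN).
  by rewrite /energy_form [(UQ n).1]Un [(UQ n).2]Qn.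
rewrite [X in X + _ <= _](sumE w wH) [X in _ + X <= _](eE N (leqnn N)).
rewrite [X in _ <= _ * (_ + X)](sumE f fH).
rewrite [X in _ <= _ * (X + _)](_ : _ =
  \sum_(i < 6) (normV Omega nu (u i) ^+ 2 + jnorm j (p i) ^+ 2)); last first.
  by apply: eq_bigr => i _; apply: eE; rewrite (leq_trans _ N6)// ltnW.
have l2_ge0 g : 0 <= l2H_sqr Omega 6 tau N g.
  by apply: mulr_ge0; [exact: ltW|apply: sumr_ge0 => n _; exact: sqr_ge0].
by move/le_scaled_sum; apply; [exact: l2_ge0| |exact: S0|exact: l2_ge0].
Qed.
End fully_discrete.

Theorem theorem5p2 (R : realType) (d : nat) (hd : d = 2%N \/ d = 3%N)
    (Omega : set 'rV[R]_d) (hOmega : lipschitz_domain Omega)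
    (nu : R) (hnu : 0 < nu)
    (Th : R -> seq 'M[R]_(d.+1, d))
    (hTh : forall h, 0 < h <= 1 -> triangulation Omega (Th h))
    (hqu : quasi_uniform Th)
    (k l : nat) (hk : (1 <= k)%N) (hkl : (k - 1 <= l <= k)%N)
    (continuous_pressure : bool)
    (Vh : R -> set ('rV[R]_d -> 'rV[R]_d))
    (hVh : forall h, Vh h = spaceVh Omega (Th h) k)
    (Qh : R -> set ('rV[R]_d -> R))
    (hQh : forall h, Qh h = spaceQh Omega (Th h) l continuous_pressure)
    (jh : R -> ('rV[R]_d -> R) -> ('rV[R]_d -> R) -> R)
    (lbar : nat) (hlbar : (1 <= lbar)%N)
    (Ip : R -> ('rV[R]_d -> R) -> ('rV[R]_d -> R))
    (Iu : R -> ('rV[R]_d -> 'rV[R]_d) -> ('rV[R]_d -> 'rV[R]_d))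
    (C0 : R) (hC0 : 0 < C0)
    (hj : forall h, 0 < h <= 1 ->
      pressure_stabilization Omega nu C0 (Qh h) (jh h))
    (hIp : forall h, 0 < h <= 1 ->
      pressure_interpolation Omega nu C0 h l lbar (Qh h) (jh h) (Ip h))
    (hIu : forall h, 0 < h <= 1 ->
      velocity_interpolation Omega nu C0 h k (Vh h) (Qh h) (jh h) (Iu h))
    (q : nat) (hq : q = 6%N) :
  exists2 C : R, 0 < C &
  forall (h : R), 0 < h <= 1 ->
  forall (T : R), 0 < T ->
  forall (tau : R) (N : nat), 0 < tau -> 0 <= N%:R * tau <= T ->
  forall f : R -> 'rV[R]_d -> 'rV[R]_d, continuous_in_H Omega T f ->
  forall (u : nat -> 'rV[R]_d -> 'rV[R]_d) (p : nat -> 'rV[R]_d -> R),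
  (forall i, (i < q)%N ->
    [/\ Vh h (u i), Qh h (p i) &
        forall qh, Qh h qh -> form_b Omega qh (u i) - jh h (p i) qh = 0]) ->
  (forall n, (q <= n <= N)%N ->
    [/\ Vh h (u n), Qh h (p n),
        forall vh, Vh h vh ->
          vip Omega (bdf q tau u n) vh + form_a Omega nu (u n) vh +
            form_b Omega (p n) vh = vip Omega (f (n%:R * tau)) vh &
        forall qh, Qh h qh -> form_b Omega qh (u n) - jh h qh (p n) = 0]) ->
  l2H_sqr Omega q tau N (bdf q tau u) + normV Omega nu (u N) ^+ 2 +
    jnorm (jh h) (p N) ^+ 2 <=
  C * (\sum_(i < q) (normV Omega nu (u i) ^+ 2 + jnorm (jh h) (p i) ^+ 2) +
       l2H_sqr Omega q tau N (fun n => f (n%:R * tau))).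
Proof.
subst q.
have [_ oO _ bO _] := hOmega.
(* An absolute number, hence independent of [h], [N], [tau] and [T]. *)
exists (60 * energy_const R).
  by rewrite mulr_gt0// (lt_le_trans _ (energy_const_ge1 R)).
move=> h h01 T T0 tau N tau0 /andP[_ NT] f [fH _] u p init scheme.
have sVh : linear_subspace (Vh h) by rewrite hVh; exact: spaceVh_subspace.
have sQh : linear_subspace (Qh h) by rewrite hQh; exact: spaceQh_subspace.
have siJ := stabilization_semi_inner sQh (hj h h01).
have VhV : Vh h `<=` spaceV Omega by rewrite hVh => v [].
have QhL2 : Qh h `<=` L2 Omega by rewrite hQh => v [[]].
have uP n : (n <= N)%N -> Vh h (u n) /\ Qh h (p n).
  move=> nN; have [n6|n6] := ltnP n 6; first by have [] := init n n6.
  by have /scheme[] : (6 <= n <= N)%N by rewrite n6.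
apply: (discrete_stability oO bO (ltW hnu) sVh VhV siJ QhL2 tau0 uP
  (f := fun n => f (n%:R * tau))) => //.
- move=> n /andP[_ nN]; apply: fH; apply/andP; split.
    by apply: mulr_ge0 => //; exact: ltW.
  by apply: le_trans NT; rewrite ler_pM2r// ler_nat.
(* The condition on the initial values has the arguments of the stabilization in the other order,
   hence the appeal to symmetry. *)
- move=> n nN qh Qqh; have [n6|n6] := ltnP n 6.
    have [_ Qp /(_ _ Qqh)/eqP] := init n n6.
    by rewrite subr_eq0 => /eqP ->; exact: (semi_inner_sym siJ Qp Qqh).
  have /scheme[_ _ _ /(_ _ Qqh)/eqP] : (6 <= n <= N)%N by rewrite n6.
  by rewrite subr_eq0 => /eqP.
- by move=> n n6 v Vv; have [_ _ /(_ _ Vv)] := scheme n n6.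
Qed.
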